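(* Let $e$ be a closed expression of $\lambda_{\mathsf{delim}}$ with $\emptyset;\mathbb N\vdash e:\mathbb N;\mathbb N$, and suppose $(\mathsf{popAux}([\![e]\!]_{\emptyset}),[])\to^*(\mathsf{Ret}(n),\sigma)$ in the reduction of guarded interaction trees, for a natural number $n$ and some continuation stack $\sigma$. Then $\langle e\rangle_{term}\mapsto^*\langle n\rangle_{ret}$ in the abstract machine of $\lambda_{\mathsf{delim}}$.
   Context: Guarded interaction trees and the semantics of $\lambda_{\mathsf{delim}}$ are as follows. In guarded type theory (Iris base logic) with later $\triangleright$, $\mathsf{Next}$, functorial action of $\triangleright$ and guarded fixed points: $\mathit{IT}$ has constructors $\mathsf{Ret}$ (ground type containing $\mathbb N$), $\mathsf{Fun}:\triangleright(\mathit{IT}\to\mathit{IT})\to\mathit{IT}$, $\mathsf{Err}$, $\mathsf{Tau}:\triangleright\mathit{IT}\to\mathit{IT}$, $\mathsf{Vis}_i:\mathsf{Ins}_i(\mathit{IT})\times(\mathsf{Outs}_i(\mathit{IT})\to\triangleright\mathit{IT})\to\mathit{IT}$; $\mathsf{Tick}=\mathsf{Tau}\circ\mathsf{Next}$. Reduction with state $\sigma$ and context-dependent reifiers $r_i(x,\sigma,k)\in\mathsf{option}(\triangleright\mathit{IT}\times S)$: $(\alpha,\sigma)\to(\beta,\sigma')$ iff $\alpha=\mathsf{Tick}\,\beta,\sigma'=\sigma$, or $\alpha=\mathsf{Vis}_i(x,k)$ with $r_i(x,\sigma,k)=\mathsf{Some}(\mathsf{Next}\,\beta,\sigma')$. Helpers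 $\mathsf{getval},\mathsf{getfun},\mathsf{getret}$, $\mathsf{APP}$ (right-to-left strict application) and $\mathsf{NATOP}$ as usual for GITrees. Syntax: types $\tau,\alpha,\beta,\ldots::=\mathbb N\mid\tau/\alpha\to\sigma/\beta\mid\mathsf{cont}(\tau,\alpha)$; expressions $e::=v\mid x\mid e_1e_2\mid e_1\odot e_2\mid\mathsf{if}\ e_1\ \mathsf{then}\ e_2\ \mathsf{else}\ e_3\mid\mathsf{shift}(x.e)\mid\mathsf{reset}(e)\mid e_1\diamond e_2$; values $v::=n\mid\mathsf{rec}\ f\ x=e\mid\mathsf{cont}(K)$. Typing judgments $\Gamma;\alpha\vdash e:\tau;\beta$ and pure $\Gamma\vdash_p e:\tau$: pure implies $\Gamma;\alpha\vdash e:\tau;\alpha$; $\Gamma,x:\mathsf{cont}(\tau,\alpha);\sigma\vdash e:\sigma;\beta$ gives $\Gamma;\alpha\vdash\mathsf{shift}(x.e):\tau;\beta$; $\Gamma;\tau\vdash e:\tau;\sigma$ gives $\Gamma\vdash_p\mathsf{reset}(e):\sigma$; $x:\tau\in\Gamma$ gives $\Gamma\vdash_p x:\tau$; $\Gamma,f:\sigma/\alpha\to\tau/\beta,x:\sigma;\alpha\vdash e:\tau;\beta$ gives $\Gamma\vdash_p\mathsf{rec}\ f\ x=e:\sigma/\alpha\to\tau/\beta$; $\Gamma;\gamma\vdash e_1:(\sigma/\alpha\to\tau/\beta);\delta$ and $\Gamma;\beta\vdash e_2:\sigma;\gamma$ give $\Gamma;\alpha\vdash e_1e_2:\tau;\delta$;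 $\Gamma;\beta\vdash e_1:\mathbb N;\alpha$, $\Gamma;\sigma\vdash e_2:\tau;\beta$, $\Gamma;\sigma\vdash e_3:\tau;\beta$ give $\Gamma;\sigma\vdash\mathsf{if}\ e_1\ \mathsf{then}\ e_2\ \mathsf{else}\ e_3:\tau;\alpha$; $\Gamma\vdash_p n:\mathbb N$; $\Gamma;\alpha\vdash e_1:\mathbb N;\beta$ and $\Gamma;\beta\vdash e_2:\mathbb N;\sigma$ give $\Gamma;\alpha\vdash e_1\odot e_2:\mathbb N;\sigma$; $\Gamma;\sigma\vdash e_1:\mathsf{cont}(\tau,\alpha);\delta$ and $\Gamma;\delta\vdash e_2:\tau;\beta$ give $\Gamma;\sigma\vdash e_1\diamond e_2:\alpha;\beta$. Abstract machine (contexts $K$, metacontinuations $mk::=[]\mid K::mk$, configurations $\langle e,K,mk\rangle_{eval}$, $\langle K,v,mk\rangle_{cont}$, $\langle mk,v\rangle_{mcont}$, $\langle e\rangle_{term}$, $\langle v\rangle_{ret}$), with transitions including $\langle e\rangle_{term}\mapsto\langle e,\square,[]\rangle_{eval}$, $\langle K::mk,v\rangle_{mcont}\mapsto\langle K,v,mk\rangle_{cont}$, $\langle[],v\rangle_{mcont}\mapsto\langle v\rangle_{ret}$, $\langle\square,v,mk\rangle_{cont}\mapsto\langle mk,v\rangle_{mcont}$, $\langle v,K,mk\rangle_{eval}\mapsto\langle K,v,mk\rangle_{cont}$, $\langle\mathsf{reset}(e),K,mk\rangle_{eval}\mapsto\langle e,\square,K::mk\rangle_{eval}$, $\langle\mathsf{shift}(k.e),K,mk\rangle_{eval}\mapsto\langle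 e[\mathsf{cont}(K)/k],\square,mk\rangle_{eval}$, $\langle e_0\diamond e_1,K,mk\rangle_{eval}\mapsto\langle e_1,K[e_0\diamond\square],mk\rangle_{eval}$, $\langle K[e\diamond\square],v,mk\rangle_{cont}\mapsto\langle e,K[\square\diamond v],mk\rangle_{eval}$, $\langle K[\square\diamond v],\mathsf{cont}(K'),mk\rangle_{cont}\mapsto\langle K',v,K::mk\rangle_{cont}$, plus the analogous standard CEK rules for application, arithmetic and conditionals. Semantics: state is a list of $\triangleright\mathit{IT}\to\triangleright\mathit{IT}$; reifiers $r_{\mathsf{reset}}(e,\sigma,\kappa)=\mathsf{Some}(e,\kappa::\sigma)$, $r_{\mathsf{shift}}(f,\sigma,\kappa)=\mathsf{Some}(f\,\kappa,\sigma)$, $r_{\mathsf{pop}}(e,[],\_)=\mathsf{Some}(e,[])$, $r_{\mathsf{pop}}(e,\kappa::\sigma,\_)=\mathsf{Some}(\kappa\,e,\sigma)$, $r_{\mathsf{appcont}}((e,\kappa),\sigma,\kappa')=\mathsf{Some}(\kappa\,e,\kappa'::\sigma)$; $\mathsf{RESET},\mathsf{SHIFT},\mathsf{APPCONT},\mathsf{POP}$ are the corresponding $\mathsf{Vis}$ nodes ($\mathsf{POP}$ never returns) and $\mathsf{popAux}(\beta)=\mathsf{getval}(\beta,\mathsf{POP})$. Denotation: standard clauses for variables, numerals ($\mathsf{Ret}\,n$), $\mathsf{APP}$, $\mathsf{NATOP}$, conditionals, $\mathsf{rec}$; $[\![\mathsf{reset}(e)]\!]_\rho=\mathsf{RESET}(\mathsf{popAux}([\![e]\!]_\rho))$;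 $[\![\mathsf{shift}(x.e)]\!]_\rho=\mathsf{SHIFT}(\mathsf{popAux}\circ(\lambda\kappa.[\![e]\!]_{\rho,x\mapsto\mathsf{Fun}(\mathsf{Next}(\lambda y.\mathsf{Tau}(\kappa(\mathsf{Next}\,y))))}))$; $[\![e_1\diamond e_2]\!]_\rho=\mathsf{getval}([\![e_2]\!]_\rho,\lambda x.\mathsf{getfun}([\![e_1]\!]_\rho,\lambda y.\mathsf{APPCONT}(\mathsf{Next}\,x,y)))$; $[\![\mathsf{cont}(K)]\!]_\rho=\mathsf{Fun}(\mathsf{Next}(\lambda x.\mathsf{Tick}(\mathsf{popAux}([\![K]\!]_\rho x))))$ with $[\![K]\!]_\rho$ the frame-by-frame interpretation of $K$ as $\mathit{IT}\to\mathit{IT}$.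
   Formalization: Application e1 e2 is evaluated function-first, both in the denotation (getval(⟦e1⟧, λf. APP(f,⟦e2⟧))) and in the machine, as its typing rule requires; with the plain right-to-left clause APP(⟦e1⟧,⟦e2⟧) and this typing rule the claim is false. *)

(* Defs.v *)
From Stdlib Require Import Arith Lia List Relations.
From Stdlib Require Import FunctionalExtensionality ProofIrrelevance.
Import ListNotations.

Set Implicit Arguments.
Unset Strict Implicit.
Unset Program Cases.

(* COFEs in which the limit equality [forall n, dist n x y] is Leibniz equality,
   so that the external equality of the guarded type theory is [=].  *)
Record cofe := Cofe {
  car :> Type;
  dist : nat -> car -> car -> Prop;
  dist_refl : forall n x, dist n x x;
  dist_sym : forall n x y, dist n x y -> dist n y x;
  dist_trans : forall n x y z, dist n x y -> dist n y z -> dist n x z;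
  dist_S : forall n x y, dist (S n) x y -> dist n x y;
  dist_eq : forall x y, (forall n, dist n x y) -> x = y;
  compl : forall c : nat -> car,
    (forall n m, n <= m -> dist n (c m) (c n)) -> car;
  compl_dist : forall c Hc n, dist n (@compl c Hc) (c n) }.
Arguments car : simpl never.
Arguments dist {_} n x y.
Arguments compl {_} c Hc.

Lemma dist_le (A : cofe) n m (x y : A) : m <= n -> dist n x y -> dist m x y.
Proof. induction 1; auto using dist_S. Qed.

Lemma eq_dist (A : cofe) n (x y : A) : x = y -> dist n x y.
Proof. intros ->; apply dist_refl. Qed.

Record hom (A B : cofe) := Hom {
  hom_fun :> A -> B;
  hom_ne : forall n x y, dist n x y -> dist n (hom_fun x) (hom_fun y) }.
Arguments Hom {A B} hom_fun hom_ne.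

Lemma hom_ext (A B : cofe) (f g : hom A B) : (forall x, f x = g x) -> f = g.
Proof.
  destruct f as [f Hf], g as [g Hg]; simpl; intros H.
  assert (f = g) by (extensionality x; apply H). subst g.
  f_equal; apply proof_irrelevance.
Qed.

Program Definition homC (A B : cofe) : cofe := {|
  car := hom A B;
  dist n f g := forall x, dist n (f x) (g x);
  compl c Hc := Hom (fun x => compl (fun n => c n x) (fun n m H => Hc n m H x)) _ |}.
Next Obligation. apply dist_refl. Qed.
Next Obligation. apply dist_sym; auto. Qed.
Next Obligation. eapply dist_trans; eauto. Qed.
Next Obligation. apply dist_S; auto. Qed.
Next Obligation. apply hom_ext; intros a; apply dist_eq; auto. Qed.
Next Obligation.
  eapply dist_trans; [apply compl_dist |].
  eapply dist_trans; [| apply dist_sym, compl_dist].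
  cbv beta. apply hom_ne; assumption.
Qed.
Next Obligation.
  eapply dist_trans; [apply compl_dist | apply dist_refl].
Qed.

Notation "A -n> B" := (homC A B) (at level 99, B at level 200, right associativity).

Lemma app_ne (A B : cofe) n (f g : A -n> B) (x y : A) :
  dist n f g -> dist n x y -> dist n (f x) (g y).
Proof.
  intros Hf Hx. eapply dist_trans; [apply hom_ne, Hx | apply Hf].
Qed.

Program Definition discreteC (A : Type) : cofe := {|
  car := A;
  dist _ x y := x = y;
  compl c _ := c 0 |}.
Next Obligation. apply (H 0). Qed.
Next Obligation. symmetry; apply (Hc 0); lia. Qed.

Program Definition piC (X : Type) (A : cofe) : cofe := {|
  car := X -> A;
  dist n f g := forall x, dist n (f x) (g x);
  compl c Hc := fun x => compl (fun n => c n x) (fun n m H => Hc n m H x) |}.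
Next Obligation. apply dist_refl. Qed.
Next Obligation. apply dist_sym; auto. Qed.
Next Obligation. eapply dist_trans; eauto. Qed.
Next Obligation. apply dist_S; auto. Qed.
Next Obligation. extensionality a; apply dist_eq; auto. Qed.
Next Obligation.
  eapply dist_trans; [apply compl_dist | apply dist_refl].
Qed.

Program Definition prodC (A B : cofe) : cofe := {|
  car := A * B;
  dist n x y := dist n (fst x) (fst y) /\ dist n (snd x) (snd y);
  compl c Hc := (compl (fun n => fst (c n)) (fun n m H => proj1 (Hc n m H)),
                 compl (fun n => snd (c n)) (fun n m H => proj2 (Hc n m H))) |}.
Next Obligation. split; apply dist_refl. Qed.
Next Obligation. split; apply dist_sym; auto. Qed.
Next Obligation. split; eapply dist_trans; eauto. Qed.
Next Obligation. split; apply dist_S; auto. Qed.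
Next Obligation. f_equal; apply dist_eq; intros n; apply (H n). Qed.
Next Obligation.
  split; (eapply dist_trans; [apply compl_dist | apply dist_refl]).
Qed.

Definition sum_dist (A B : cofe) n (x y : A + B) : Prop :=
  match x, y with
  | inl a, inl a' => dist n a a'
  | inr b, inr b' => dist n b b'
  | _, _ => False
  end.
Definition get_inl {A B : Type} (a : A) (x : A + B) : A :=
  match x with inl a' => a' | inr _ => a end.
Definition get_inr {A B : Type} (b : B) (x : A + B) : B :=
  match x with inr b' => b' | inl _ => b end.

Lemma inl_cauchy (A B : cofe) (c : nat -> A + B) (a : A) :
  (forall n m, n <= m -> sum_dist n (c m) (c n)) ->
  forall n m, n <= m -> dist n (get_inl a (c m)) (get_inl a (c n)).
Proof.
  intros Hc n m H. specialize (Hc n m H). unfold sum_dist in Hc.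
  destruct (c m), (c n); simpl in *; tauto || apply dist_refl.
Qed.
Lemma inr_cauchy (A B : cofe) (c : nat -> A + B) (b : B) :
  (forall n m, n <= m -> sum_dist n (c m) (c n)) ->
  forall n m, n <= m -> dist n (get_inr b (c m)) (get_inr b (c n)).
Proof.
  intros Hc n m H. specialize (Hc n m H). unfold sum_dist in Hc.
  destruct (c m), (c n); simpl in *; tauto || apply dist_refl.
Qed.

Program Definition sumC (A B : cofe) : cofe := {|
  car := A + B;
  dist := @sum_dist A B;
  compl c Hc :=
    match c 0 with
    | inl a => inl (compl (fun n => get_inl a (c n)) (inl_cauchy a Hc))
    | inr b => inr (compl (fun n => get_inr b (c n)) (inr_cauchy b Hc))
    end |}.
Next Obligation. destruct x; simpl; apply dist_refl. Qed.
Next Obligation. destruct x, y; simpl in *; auto; apply dist_sym; auto. Qed.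
Next Obligation.
  destruct x, y, z; simpl in *; try tauto; eapply dist_trans; eauto.
Qed.
Next Obligation. destruct x, y; simpl in *; auto; apply dist_S; auto. Qed.
Next Obligation.
  destruct x, y; simpl in *;
    try (destruct (H 0); fail); f_equal; apply dist_eq; auto.
Qed.
Next Obligation.
  pose proof (Hc 0 n (Nat.le_0_l n)) as H0. unfold sum_dist in *.
  destruct (c 0) as [a|b].
  - destruct (c n) as [a'|] eqn:E; [| destruct H0].
    eapply dist_trans; [apply compl_dist |]. rewrite E. apply dist_refl.
  - destruct (c n) as [|b'] eqn:E; [destruct H0 |].
    eapply dist_trans; [apply compl_dist |]. rewrite E. apply dist_refl.
Qed.

Record later (A : Type) := Next { later_car : A }.
Arguments Next {A} later_car.

Definition later_dist (A : cofe) n (x y : later A) : Prop :=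
  match n with 0 => True | S n => dist n (later_car x) (later_car y) end.

Lemma later_cauchy (A : cofe) (c : nat -> later A) :
  (forall n m, n <= m -> later_dist n (c m) (c n)) ->
  forall n m, n <= m -> dist n (later_car (c (S m))) (later_car (c (S n))).
Proof. intros Hc n m H. apply (Hc (S n) (S m)); lia. Qed.

Program Definition laterC (A : cofe) : cofe := {|
  car := later A;
  dist := @later_dist A;
  compl c Hc := Next (compl (fun n => later_car (c (S n))) (later_cauchy Hc)) |}.
Next Obligation. destruct n; simpl; auto using dist_refl. Qed.
Next Obligation. destruct n; simpl in *; auto using dist_sym. Qed.
Next Obligation. destruct n; simpl in *; eauto using dist_trans. Qed.
Next Obligation. destruct n; simpl in *; auto using dist_S. Qed.
Next Obligation.
  destruct x as [x], y as [y]; f_equal; apply dist_eq; intros n; apply (H (S n)).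
Qed.
Next Obligation.
  destruct n; simpl; [exact I |].
  eapply dist_trans; [apply compl_dist | apply dist_refl].
Qed.

Notation "▷ A" := (laterC A) (at level 20, right associativity).

Definition idC {A : cofe} : A -n> A := Hom (fun x => x) (fun _ _ _ H => H).

Definition constC {A B : cofe} (b : B) : A -n> B :=
  Hom (fun _ => b) (fun n _ _ _ => dist_refl n b).

Program Definition compC {A B C : cofe} (g : B -n> C) (f : A -n> B) : A -n> C :=
  Hom (fun x => g (f x)) _.
Next Obligation. apply hom_ne, hom_ne; assumption. Qed.

Program Definition nextC {A : cofe} : A -n> ▷ A := Hom (@Next A) _.
Next Obligation. destruct n; simpl; auto using dist_S. Qed.

Definition later_ap {A B : cofe} (f : ▷ (A -n> B)) (x : ▷ A) : ▷ B :=
  Next (later_car f (later_car x)).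

Program Definition lap {A B : cofe} : ▷ (A -n> B) -n> ▷ A -n> ▷ B :=
  Hom (fun f => Hom (later_ap f) _) _.
Next Obligation. destruct n; simpl in *; auto. apply hom_ne; auto. Qed.
Next Obligation. destruct n; simpl in *; auto. Qed.

Definition lmap {A B : cofe} (f : A -n> B) : ▷ A -n> ▷ B := lap (Next f).

Lemma Next_ne (A : cofe) n (x y : A) :
  (forall m, m < n -> dist m x y) -> @dist (▷ A) n (Next x) (Next y).
Proof. destruct n; simpl; auto. Qed.

(** Guarded fixed points: [mu a f = f (Next (mu a f))]; the inhabitant [a]
    only seeds the approximating sequence. *)

Fixpoint mu_iter (A : cofe) (a : A) (f : ▷ A -n> A) (n : nat) : A :=
  match n with
  | 0 => f (Next a)
  | S n => f (Next (mu_iter a f n))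
  end.

Lemma mu_cauchy (A : cofe) (a : A) (f : ▷ A -n> A) n m :
  n <= m -> dist n (mu_iter a f m) (mu_iter a f n).
Proof.
  revert m; induction n as [|n IH]; intros m H.
  - destruct m; apply hom_ne; exact I.
  - destruct m as [|m]; [lia |]. apply hom_ne. simpl. apply IH; lia.
Qed.

Definition mu {A : cofe} (a : A) (f : ▷ A -n> A) : A :=
  compl (mu_iter a f) (@mu_cauchy A a f).

Lemma mu_eq (A : cofe) (a : A) (f : ▷ A -n> A) : mu a f = f (Next (mu a f)).
Proof.
  apply dist_eq; intros n. eapply dist_trans; [apply compl_dist |].
  destruct n as [|n]; simpl; apply hom_ne; simpl; [exact I |].
  apply dist_sym, compl_dist.
Qed.

Lemma mu_ne (A : cofe) (a : A) n (f g : ▷ A -n> A) :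
  dist n f g -> dist n (mu a f) (mu a g).
Proof.
  intros H. induction n as [|n IH]; rewrite (mu_eq a f), (mu_eq a g).
  - eapply dist_trans; [apply H | apply hom_ne; exact I].
  - eapply dist_trans; [apply H | apply hom_ne; simpl; apply IH].
    intros x; apply dist_S, H.
Qed.

#[global] Opaque mu.

Record functor := Functor {
  fobj :> cofe -> cofe -> cofe;
  fmap : forall {A A' B B' : cofe},
    (A' -n> A) -> (B -n> B') -> fobj A B -n> fobj A' B';
  fmap_ne : forall (A A' B B' : cofe) n (f f' : A' -n> A) (g g' : B -n> B'),
    dist n f f' -> dist n g g' -> dist n (fmap f g) (fmap f' g');
  fmap_id : forall (A B : cofe) (x : fobj A B), fmap idC idC x = x;
  fmap_comp : forall (A A' A'' B B' B'' : cofe)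
    (f : A' -n> A) (f' : A'' -n> A') (g : B -n> B') (g' : B' -n> B'') x,
    fmap (compC f f') (compC g' g) x = fmap f' g' (fmap f g x) }.

Definition contractive (F : functor) : Prop :=
  forall (A A' B B' : cofe) n (f f' : A' -n> A) (g g' : B -n> B'),
    (forall m, m < n -> dist m f f') -> (forall m, m < n -> dist m g g') ->
    dist n (fmap F f g) (fmap F f' g').

Program Definition constF (C : cofe) : functor := {|
  fobj _ _ := C;
  fmap _ _ _ _ _ _ := idC |}.
Next Obligation. apply dist_refl. Qed.

Program Definition idF : functor := {|
  fobj _ B := B;
  fmap _ _ _ _ _ g := g |}.

Program Definition prodF (F G : functor) : functor := {|
  fobj A B := prodC (F A B) (G A B);
  fmap _ _ _ _ f g := Hom (fun x => (fmap F f g (fst x), fmap G f g (snd x))) _ |}.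
Next Obligation. split; apply hom_ne; assumption. Qed.
Next Obligation. split; apply fmap_ne; auto. Qed.
Next Obligation. destruct x; f_equal; apply fmap_id. Qed.
Next Obligation. f_equal; apply fmap_comp. Qed.

Program Definition sumF (F G : functor) : functor := {|
  fobj A B := sumC (F A B) (G A B);
  fmap _ _ _ _ f g := Hom (fun x =>
    match x with
    | inl y => inl (fmap F f g y)
    | inr y => inr (fmap G f g y)
    end) _ |}.
Next Obligation.
  destruct x, y; simpl in *; auto; apply hom_ne; assumption.
Qed.
Next Obligation. destruct x; simpl; apply fmap_ne; auto. Qed.
Next Obligation. destruct x; f_equal; apply fmap_id. Qed.
Next Obligation. destruct x; f_equal; apply fmap_comp. Qed.

Program Definition laterF (F : functor) : functor := {|
  fobj A B := ▷ (F A B);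
  fmap _ _ _ _ f g := lmap (fmap F f g) |}.
Next Obligation. destruct n; simpl; auto. apply fmap_ne; intros y; apply dist_S; auto. Qed.
Next Obligation.
  unfold later_ap; simpl; rewrite fmap_id; destruct x; reflexivity.
Qed.
Next Obligation. unfold later_ap; simpl; rewrite fmap_comp; reflexivity. Qed.

Program Definition homF (F G : functor) : functor := {|
  fobj A B := F B A -n> G A B;
  fmap _ _ _ _ f g := Hom (fun h => compC (fmap G f g) (compC h (fmap F g f))) _ |}.
Next Obligation. apply hom_ne, H. Qed.
Next Obligation.
  apply app_ne; [apply fmap_ne; auto | apply hom_ne, fmap_ne; auto].
Qed.
Next Obligation. apply hom_ext; intros y; simpl; rewrite !fmap_id; reflexivity. Qed.
Next Obligation. apply hom_ext; intros y; simpl; rewrite !fmap_comp; reflexivity. Qed.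

Lemma constF_contractive C : contractive (constF C).
Proof. intros A A' B B' n f f' g g' _ _; apply dist_refl. Qed.
Lemma prodF_contractive F G :
  contractive F -> contractive G -> contractive (prodF F G).
Proof.
  intros HF HG A A' B B' n f f' g g' Hf Hg x; split; [apply HF | apply HG]; auto.
Qed.
Lemma sumF_contractive F G :
  contractive F -> contractive G -> contractive (sumF F G).
Proof.
  intros HF HG A A' B B' n f f' g g' Hf Hg [x|x]; [apply HF | apply HG]; auto.
Qed.
Lemma homF_contractive F G :
  contractive F -> contractive G -> contractive (homF F G).
Proof.
  intros HF HG A A' B B' n f f' g g' Hf Hg x y; simpl.
  apply app_ne; [apply HG; auto | apply hom_ne, HF; auto].
Qed.
Lemma laterF_contractive F : contractive (laterF F).
Proof.
  intros A A' B B' n f f' g g' Hf Hg x. destruct n as [|n]; [exact I |].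
  simpl. apply (@fmap_ne F); [apply Hf | apply Hg]; lia.
Qed.

(** The solution [tower] of [T ≅ F T T] for contractive [F]: the limit of
    [unit <- F unit unit <- ...]. *)

Section Solver.
  Variable F : functor.
  Hypothesis HF : contractive F.
  Variable inh : F (discreteC unit) (discreteC unit).

  Fixpoint approx (k : nat) : cofe :=
    match k with 0 => discreteC unit | S k => F (approx k) (approx k) end.

  Fixpoint up (k : nat) : approx k -n> approx (S k) :=
    match k with
    | 0 => constC inh
    | S k => fmap F (down k) (up k)
    end
  with down (k : nat) : approx (S k) -n> approx k :=
    match k with
    | 0 => @constC (approx 1) (discreteC unit) tt
    | S k => fmap F (up k) (down k)
    end.

  Lemma fmap_ext (A A' B B' : cofe) (f f' : A' -n> A) (g g' : B -n> B') x :
    (forall y, f y = f' y) -> (forall y, g y = g' y) ->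
    fmap F f g x = fmap F f' g' x.
  Proof.
    intros Hf Hg. rewrite (hom_ext Hf), (hom_ext Hg). reflexivity.
  Qed.

  Lemma down_up k x : down k (up k x) = x.
  Proof.
    revert x; induction k as [|k IH]; intros x; [destruct x; reflexivity |].
    change (fmap F (up k) (down k) (fmap F (down k) (up k) x) = x).
    rewrite <- fmap_comp.
    etransitivity; [| apply fmap_id]. apply fmap_ext; exact IH.
  Qed.

  Lemma up_down k n x : n < k -> dist n (up k (down k x)) x.
  Proof.
    revert n x; induction k as [|k IH]; intros n x Hn; [lia |].
    change (dist n (fmap F (down k) (up k) (fmap F (up k) (down k) x)) x).
    rewrite <- fmap_comp.
    apply dist_trans with (y := fmap F idC idC x);
      [| rewrite fmap_id; apply dist_refl].
    refine (HF (f' := idC) (g' := idC) _ _ x); intros m Hm y; apply IH; lia.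
  Qed.

  (* [coe k i] embeds or projects [approx k] into [approx i]. *)
  Fixpoint coe_unit (i : nat) : discreteC unit -n> approx i :=
    match i with
    | 0 => idC
    | S i => compC (up i) (coe_unit i)
    end.

  Fixpoint coes (k i : nat) {struct k} :
      (approx k -n> approx i) * (approx i -n> approx k) :=
    match k with
    | 0 => (coe_unit i, @constC _ (discreteC unit) tt)
    | S k =>
      match i with
      | 0 => (@constC _ (discreteC unit) tt, coe_unit (S k))
      | S i => (fmap F (snd (coes k i)) (fst (coes k i)),
                fmap F (fst (coes k i)) (snd (coes k i)))
      end
    end.
  Definition coe (k i : nat) : approx k -n> approx i := fst (coes k i).

  Lemma coes_swap k i :
    fst (coes k i) = snd (coes i k) /\ snd (coes k i) = fst (coes i k).
  Proof.
    revert i; induction k as [|k IH]; intros [|i]; simpl; auto.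
    - split; apply hom_ext; intros []; reflexivity.
    - destruct (IH i) as [-> ->]; auto.
  Qed.

  Lemma coe_0_S i : coe 0 (S i) = compC (up i) (coe 0 i).
  Proof. reflexivity. Qed.
  Lemma coe_S_S k i : coe (S k) (S i) = fmap F (coe i k) (coe k i).
  Proof. unfold coe; simpl. destruct (coes_swap k i) as [_ ->]; reflexivity. Qed.

  Lemma unit_eq (x y : approx 0) : x = y.
  Proof. destruct x, y; reflexivity. Qed.

  Lemma coe_id k x : coe k k x = x.
  Proof.
    revert x; induction k as [|k IH]; intros x; [apply unit_eq |].
    rewrite coe_S_S. etransitivity; [| apply fmap_id].
    apply fmap_ext; exact IH.
  Qed.

  Lemma coe_1_inh i : coe 1 (S i) inh = coe 0 (S i) tt.
  Proof.
    induction i as [|i IH]; [apply coe_id |].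
    change (coe 1 (S (S i)) inh = up (S i) (coe 0 (S i) tt)).
    rewrite <- IH, !coe_S_S.
    change (fmap F (coe (S i) 0) (coe 0 (S i)) inh =
      fmap F (down i) (up i) (fmap F (coe i 0) (coe 0 i) inh)).
    rewrite <- fmap_comp. apply fmap_ext; intros y; [apply unit_eq | reflexivity].
  Qed.

  Lemma coe_up_down k i :
    (forall x, coe (S k) i (up k x) = coe k i x) /\
    (forall x, coe (S i) k (up i x) = coe i k x) /\
    (forall x, down i (coe k (S i) x) = coe k i x) /\
    (forall x, down k (coe i (S k) x) = coe i k x).
  Proof.
    assert (Hup : forall i x, coe 1 i (up 0 x) = coe 0 i x).
    { intros [|j] x; [apply unit_eq |]. destruct x. apply coe_1_inh. }
    assert (Hdown : forall i x, down i (coe 0 (S i) x) = coe 0 i x).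
    { intros j x. rewrite coe_0_S. apply down_up. }
    revert i; induction k as [|k IH]; intros [|i].
    - repeat split; intros x; apply unit_eq.
    - repeat split; intros x; auto using unit_eq.
    - repeat split; intros x; auto using unit_eq.
    - destruct (IH i) as (H1 & H2 & H3 & H4).
      repeat split; intros x; rewrite !coe_S_S; simpl up; simpl down;
        (etransitivity; [symmetry; apply fmap_comp |]);
        apply fmap_ext; intros y; simpl; auto.
  Qed.
  Lemma coe_up k i x : coe (S k) i (up k x) = coe k i x.
  Proof. apply coe_up_down. Qed.
  Lemma down_coe k i x : down i (coe k (S i) x) = coe k i x.
  Proof. apply coe_up_down. Qed.

  Record tower := Tower {
    tower_car :> forall k, approx k;
    tower_down : forall k, down k (tower_car (S k)) = tower_car k }.

  Lemma tower_ext (X Y : tower) : (forall k, X k = Y k) -> X = Y.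
  Proof.
    destruct X as [X HX], Y as [Y HY]; simpl; intros H.
    assert (X = Y) by (extensionality k; apply H). subst Y.
    f_equal; apply proof_irrelevance.
  Qed.

  Program Definition towerC : cofe := {|
    car := tower;
    dist n X Y := forall k, dist n (X k) (Y k);
    compl c Hc := @Tower (fun k => compl (fun n => c n k) (fun n m H => Hc n m H k)) _ |}.
  Next Obligation. apply dist_refl. Qed.
  Next Obligation. apply dist_sym; auto. Qed.
  Next Obligation. eapply dist_trans; eauto. Qed.
  Next Obligation. apply dist_S; auto. Qed.
  Next Obligation. apply tower_ext; intros k; apply dist_eq; auto. Qed.
  Next Obligation.
    apply dist_eq; intros n.
    eapply dist_trans; [apply hom_ne, compl_dist |].
    eapply dist_trans; [| apply dist_sym, compl_dist].
    cbv beta. apply eq_dist, tower_down.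
  Qed.
  Next Obligation. eapply dist_trans; [apply compl_dist | apply dist_refl]. Qed.

  Program Definition project (k : nat) : towerC -n> approx k :=
    Hom (fun X : towerC => (X : tower) k) _.

  Program Definition embed (k : nat) : approx k -n> towerC :=
    Hom (fun x => (@Tower (fun i => coe k i x) (fun i => @down_coe k i x) : towerC)) _.
  Next Obligation. apply hom_ne; assumption. Qed.

  Lemma coe_tower_le (X : tower) k i : i <= k -> coe k i (X k) = X i.
  Proof.
    intros H. replace i with (k - (k - i)) by lia.
    generalize (k - i) as d; clear i H. induction d as [|d IH].
    - rewrite Nat.sub_0_r. apply coe_id.
    - destruct (k - d) as [|j] eqn:E.
      + replace (k - S d) with 0 by lia. apply unit_eq.
      + replace (k - S d) with j by lia.
        rewrite <- down_coe, IH. apply tower_down.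
  Qed.

  Lemma coe_tower (X : tower) k i : dist k (coe (S k) i (X (S k))) (X i).
  Proof.
    induction i as [|i IH].
    - rewrite (unit_eq (coe (S k) 0 _) (X 0)). apply dist_refl.
    - destruct (le_lt_dec (S i) (S k)) as [H|H].
      + rewrite coe_tower_le by assumption. apply dist_refl.
      + eapply dist_trans; [apply dist_sym, up_down with (n := k); lia |].
        eapply dist_trans; [| apply up_down with (n := k); lia].
        apply hom_ne. rewrite down_coe, tower_down. exact IH.
  Qed.

  Lemma embed_project k (X : towerC) : dist k (embed (S k) (project (S k) X)) X.
  Proof. intros i. apply coe_tower. Qed.

  Definition unfold_seq (X : towerC) (n : nat) : F towerC towerC :=
    fmap F (project n) (embed n) (project (S n) X).

  Lemma unfold_seq_S (X : towerC) n :
    dist n (unfold_seq X (S n)) (unfold_seq X n).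
  Proof.
    unfold unfold_seq.
    eapply dist_trans.
    { apply hom_ne, dist_sym, up_down with (n := n). lia. }
    change (dist n
      (fmap F (project (S n)) (embed (S n))
        (fmap F (down n) (up n) (down (S n) (project (S (S n)) X))))
      (fmap F (project n) (embed n) (project (S n) X))).
    rewrite <- fmap_comp.
    eapply dist_trans; [apply hom_ne, eq_dist, (tower_down X (S n)) |].
    apply eq_dist, fmap_ext.
    - intros Y. apply tower_down.
    - intros y. apply tower_ext; intros i. apply coe_up.
  Qed.

  Lemma unfold_cauchy (X : towerC) n m :
    n <= m -> dist n (unfold_seq X m) (unfold_seq X n).
  Proof.
    induction 1 as [|m H IH]; [apply dist_refl |].
    eapply dist_trans; [| exact IH].
    eapply dist_le; [exact H | apply unfold_seq_S].
  Qed.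

  Program Definition t_unfold : towerC -n> F towerC towerC :=
    Hom (fun X => compl (unfold_seq X) (unfold_cauchy X)) _.
  Next Obligation.
    eapply dist_trans; [apply compl_dist |].
    eapply dist_trans; [| apply dist_sym, compl_dist].
    unfold unfold_seq. apply hom_ne, hom_ne. exact H.
  Qed.

  Program Definition t_fold : F towerC towerC -n> towerC :=
    Hom (fun X => (@Tower (fun k => down k (fmap F (embed k) (project k) X)) _ : towerC)) _.
  Next Obligation.
    f_equal. etransitivity; [symmetry; apply fmap_comp | apply fmap_ext].
    - intros y. apply tower_ext; intros i. apply coe_up.
    - intros Y. apply tower_down.
  Qed.
  Next Obligation. apply hom_ne, hom_ne. assumption. Qed.

  Lemma t_fold_unfold X : t_fold (t_unfold X) = X.
  Proof.
    apply tower_ext; intros k. apply dist_eq; intros n.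
    change (t_fold (t_unfold X) k) with
      (down k (fmap F (embed k) (project k) (t_unfold X))).
    eapply dist_trans.
    { apply hom_ne, hom_ne. eapply dist_le with (n := n + k); [lia |].
      apply compl_dist. }
    unfold unfold_seq. rewrite <- fmap_comp.
    apply eq_dist. etransitivity; [| apply tower_down]. f_equal.
    etransitivity; [| apply (@coe_tower_le X (S (n + k)) (S k)); lia].
    rewrite coe_S_S. apply fmap_ext; reflexivity.
  Qed.

  Lemma t_unfold_fold X : t_unfold (t_fold X) = X.
  Proof.
    apply dist_eq; intros n.
    eapply dist_trans; [eapply dist_le with (n := S n); [lia | apply compl_dist] |].
    unfold unfold_seq.
    change (dist n (fmap F (project (S n)) (embed (S n))
      (fmap F (up (S n)) (down (S n)) (fmap F (embed (S (S n))) (project (S (S n))) X))) X).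
    rewrite <- !fmap_comp.
    apply dist_trans with (y := fmap F idC idC X); [| apply eq_dist, fmap_id].
    refine (HF (f' := idC) (g' := idC) _ _ X); intros m Hm Y;
      apply dist_le with (n := n); try lia.
    - eapply dist_trans; [| apply embed_project].
      apply eq_dist, tower_ext; intros i. apply coe_up.
    - eapply dist_trans; [| apply embed_project].
      apply (hom_ne (embed (S n))). apply eq_dist, tower_down.
  Qed.
End Solver.


(* One summand per constructor [Ret], [Fun], [Err], [Tau] and per effect
   [Vis_i : Ins_i * (Outs_i -> ▷ IT)], for [shift], [reset], [pop], [appcont].
   The ground type is [nat + G]: it contains [nat], the rest [G] is arbitrary. *)
Definition nodeC (G : Type) (X : cofe) : cofe :=
  sumC (discreteC (nat + G))
  (sumC (▷ (X -n> X))
  (sumC (discreteC unit)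
  (sumC (▷ X)
  (sumC (prodC ((▷ X -n> ▷ X) -n> ▷ X) (▷ X -n> ▷ X))
  (sumC (prodC (▷ X) (▷ X -n> ▷ X))
  (sumC (prodC (▷ X) (discreteC Empty_set -n> ▷ X))
        (prodC (prodC (▷ X) (▷ (X -n> X))) (▷ X -n> ▷ X)))))))).

Notation RetN a := (inl a) (only parsing).
Notation FunN f := (inr (inl f)) (only parsing).
Notation ErrN := (inr (inr (inl tt))) (only parsing).
Notation TauN t := (inr (inr (inr (inl t)))) (only parsing).
Notation ShiftN x k := (inr (inr (inr (inr (inl (x, k)))))) (only parsing).
Notation ResetN x k := (inr (inr (inr (inr (inr (inl (x, k))))))) (only parsing).
Notation PopN x k := (inr (inr (inr (inr (inr (inr (inl (x, k)))))))) (only parsing).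
Notation AppcontN x k := (inr (inr (inr (inr (inr (inr (inr (x, k)))))))) (only parsing).

Record it_solution (G : Type) := ItSolution {
  it_car : cofe;
  it_in : nodeC G it_car -n> it_car;
  it_out : it_car -n> nodeC G it_car;
  it_in_out : forall t, it_in (it_out t) = t;
  it_out_in : forall t, it_out (it_in t) = t }.

Definition nodeF (G : Type) : functor :=
  let L := laterF idF in
  let visF Ins Outs := prodF Ins (homF Outs L) in
  sumF (constF (discreteC (nat + G)))
  (sumF (laterF (homF idF idF))
  (sumF (constF (discreteC unit))
  (sumF L
  (sumF (visF (homF (homF L L) L) L)
  (sumF (visF L L)
  (sumF (visF L (constF (discreteC Empty_set)))
        (visF (prodF L (laterF (homF idF idF))) L))))))).

Lemma nodeF_contractive G : contractive (nodeF G).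
Proof.
  repeat first [ apply constF_contractive | apply laterF_contractive
               | apply homF_contractive | apply prodF_contractive
               | apply sumF_contractive ].
Qed.

Lemma nodeF_nodeC G X : nodeF G X X = nodeC G X.
Proof. reflexivity. Qed.

(* Opaque on purpose: only the isomorphism matters, solutions of the domain
   equation being unique up to isomorphism. *)
Lemma it_solution_exists (G : Type) : it_solution G.
Proof.
  pose (inh := ErrN : nodeF G (discreteC unit) (discreteC unit)).
  generalize (t_fold inh) (t_unfold (@nodeF_contractive G) inh)
    (t_fold_unfold (@nodeF_contractive G) (inh := inh))
    (t_unfold_fold (@nodeF_contractive G) (inh := inh)).
  generalize (towerC inh) as X. intros X. rewrite nodeF_nodeC.
  intros f u H1 H2. exact (ItSolution H1 H2).
Qed.

Inductive ty : Set :=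
| Tnat
| Tarr (τ α σ β : ty)   (* τ/α → σ/β *)
| Tcont (τ α : ty).

Inductive nat_op : Set := Add | Sub | Mul.
Definition do_natop (op : nat_op) : nat -> nat -> nat :=
  match op with Add => Nat.add | Sub => Nat.sub | Mul => Nat.mul end.

(* Well-scoped terms over a set [X] of variables. In [RecV e] the variable [None]
   is the argument and [Some None] the function itself. A context is written from
   the hole outwards: [AppLK e K] is [K[□ e]], [AppRK v K] is [K[v □]]. *)
Inductive expr (X : Set) : Set :=
| Val (v : val X)
| Var (x : X)
| App (e1 e2 : expr X)
| NatOp (op : nat_op) (e1 e2 : expr X)
| If (e1 e2 e3 : expr X)
| Shift (e : expr (option X))
| Reset (e : expr X)
| AppCont (e1 e2 : expr X)
with val (X : Set) : Set :=
| LitV (n : nat)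
| RecV (e : expr (option (option X)))
| ContV (K : ctx X)
with ctx (X : Set) : Set :=
| EndK
| AppLK (e : expr X) (K : ctx X)
| AppRK (v : val X) (K : ctx X)
| NatOpLK (op : nat_op) (v : val X) (K : ctx X)
| NatOpRK (op : nat_op) (e : expr X) (K : ctx X)
| IfK (e1 e2 : expr X) (K : ctx X)
| AppContLK (v : val X) (K : ctx X)
| AppContRK (e : expr X) (K : ctx X).
Arguments LitV {X} n.
Arguments EndK {X}.

Definition extend {X T : Type} (g : X -> T) (t : T) (o : option X) : T :=
  match o with Some x => g x | None => t end.

Definition empty_map {T : Type} (x : Empty_set) : T := match x with end.

Fixpoint ren_expr {X Y : Set} (r : X -> Y) (e : expr X) : expr Y :=
  match e with
  | Val v => Val (ren_val r v)
  | Var x => Var (r x)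
  | App e1 e2 => App (ren_expr r e1) (ren_expr r e2)
  | NatOp op e1 e2 => NatOp op (ren_expr r e1) (ren_expr r e2)
  | If e1 e2 e3 => If (ren_expr r e1) (ren_expr r e2) (ren_expr r e3)
  | Shift e => Shift (ren_expr (option_map r) e)
  | Reset e => Reset (ren_expr r e)
  | AppCont e1 e2 => AppCont (ren_expr r e1) (ren_expr r e2)
  end
with ren_val {X Y : Set} (r : X -> Y) (v : val X) : val Y :=
  match v with
  | LitV n => LitV n
  | RecV e => RecV (ren_expr (option_map (option_map r)) e)
  | ContV K => ContV (ren_ctx r K)
  end
with ren_ctx {X Y : Set} (r : X -> Y) (K : ctx X) : ctx Y :=
  match K with
  | EndK => EndK
  | AppLK e K => AppLK (ren_expr r e) (ren_ctx r K)
  | AppRK v K => AppRK (ren_val r v) (ren_ctx r K)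
  | NatOpLK op v K => NatOpLK op (ren_val r v) (ren_ctx r K)
  | NatOpRK op e K => NatOpRK op (ren_expr r e) (ren_ctx r K)
  | IfK e1 e2 K => IfK (ren_expr r e1) (ren_expr r e2) (ren_ctx r K)
  | AppContLK v K => AppContLK (ren_val r v) (ren_ctx r K)
  | AppContRK e K => AppContRK (ren_expr r e) (ren_ctx r K)
  end.

Definition lift {X Y : Set} (s : X -> expr Y) : option X -> expr (option Y) :=
  extend (fun x => ren_expr Some (s x)) (Var None).

Fixpoint subst_expr {X Y : Set} (s : X -> expr Y) (e : expr X) : expr Y :=
  match e with
  | Val v => Val (subst_val s v)
  | Var x => s x
  | App e1 e2 => App (subst_expr s e1) (subst_expr s e2)
  | NatOp op e1 e2 => NatOp op (subst_expr s e1) (subst_expr s e2)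
  | If e1 e2 e3 => If (subst_expr s e1) (subst_expr s e2) (subst_expr s e3)
  | Shift e => Shift (subst_expr (lift s) e)
  | Reset e => Reset (subst_expr s e)
  | AppCont e1 e2 => AppCont (subst_expr s e1) (subst_expr s e2)
  end
with subst_val {X Y : Set} (s : X -> expr Y) (v : val X) : val Y :=
  match v with
  | LitV n => LitV n
  | RecV e => RecV (subst_expr (lift (lift s)) e)
  | ContV K => ContV (subst_ctx s K)
  end
with subst_ctx {X Y : Set} (s : X -> expr Y) (K : ctx X) : ctx Y :=
  match K with
  | EndK => EndK
  | AppLK e K => AppLK (subst_expr s e) (subst_ctx s K)
  | AppRK v K => AppRK (subst_val s v) (subst_ctx s K)
  | NatOpLK op v K => NatOpLK op (subst_val s v) (subst_ctx s K)
  | NatOpRK op e K => NatOpRK op (subst_expr s e) (subst_ctx s K)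
  | IfK e1 e2 K => IfK (subst_expr s e1) (subst_expr s e2) (subst_ctx s K)
  | AppContLK v K => AppContLK (subst_val s v) (subst_ctx s K)
  | AppContRK e K => AppContRK (subst_expr s e) (subst_ctx s K)
  end.

Definition subst1 {X : Set} (e : expr (option X)) (v : val X) : expr X :=
  subst_expr (extend (@Var X) (Val v)) e.
(* [e[vf/f, vx/x]] *)
Definition subst2 {X : Set} (e : expr (option (option X))) (vf vx : val X) : expr X :=
  subst_expr (extend (extend (@Var X) (Val vf)) (Val vx)) e.

(* [typed Γ α e τ β] is [Γ; α ⊢ e : τ; β] and [ptyped Γ e τ] is [Γ ⊢p e : τ]. *)
Inductive typed : forall X : Set, (X -> ty) -> ty -> expr X -> ty -> ty -> Prop :=
| typed_pure (X : Set) (Γ : X -> ty) e τ α :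
    ptyped Γ e τ -> typed Γ α e τ α
| typed_shift (X : Set) (Γ : X -> ty) e τ α σ β :
    typed (extend Γ (Tcont τ α)) σ e σ β -> typed Γ α (Shift e) τ β
| typed_app (X : Set) (Γ : X -> ty) e1 e2 σ α τ β γ δ :
    typed Γ γ e1 (Tarr σ α τ β) δ -> typed Γ β e2 σ γ ->
    typed Γ α (App e1 e2) τ δ
| typed_if (X : Set) (Γ : X -> ty) e1 e2 e3 τ α β σ :
    typed Γ β e1 Tnat α -> typed Γ σ e2 τ β -> typed Γ σ e3 τ β ->
    typed Γ σ (If e1 e2 e3) τ α
| typed_natop (X : Set) (Γ : X -> ty) op e1 e2 α β σ :
    typed Γ α e1 Tnat β -> typed Γ β e2 Tnat σ ->
    typed Γ α (NatOp op e1 e2) Tnat σ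
| typed_appcont (X : Set) (Γ : X -> ty) e1 e2 τ α β δ σ :
    typed Γ σ e1 (Tcont τ α) δ -> typed Γ δ e2 τ β ->
    typed Γ σ (AppCont e1 e2) α β
with ptyped : forall X : Set, (X -> ty) -> expr X -> ty -> Prop :=
| ptyped_reset (X : Set) (Γ : X -> ty) e τ σ :
    typed Γ τ e τ σ -> ptyped Γ (Reset e) σ
| ptyped_var (X : Set) (Γ : X -> ty) x τ :
    Γ x = τ -> ptyped Γ (Var x) τ
| ptyped_rec (X : Set) (Γ : X -> ty) e σ α τ β :
    typed (extend (extend Γ (Tarr σ α τ β)) σ) α e τ β ->
    ptyped Γ (Val (RecV e)) (Tarr σ α τ β)
| ptyped_lit (X : Set) (Γ : X -> ty) n :
    ptyped Γ (Val (LitV n)) Tnat.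

Notation cexpr := (expr Empty_set).
Notation cval := (val Empty_set).
Notation cctx := (ctx Empty_set).
Definition mctx : Set := list cctx.

Inductive config : Set :=
| Ceval (e : cexpr) (K : cctx) (mk : mctx)
| Ccont (K : cctx) (v : cval) (mk : mctx)
| Cmcont (mk : mctx) (v : cval)
| Cterm (e : cexpr)
| Cret (v : cval).

(* Evaluation order follows the threading of answer types in the typing rules:
   [typed_app] types [e1] as evaluated first, [typed_natop] and [typed_appcont]
   type [e2] as evaluated first. Evaluating arguments first would let a program
   typed by [typed_app] pass a function where a continuation is expected. *)
Inductive step : config -> config -> Prop :=
| step_term e : step (Cterm e) (Ceval e EndK [])
| step_val v K mk : step (Ceval (Val v) K mk) (Ccont K v mk)
| step_app e0 e1 K mk :
    step (Ceval (App e0 e1) K mk) (Ceval e0 (AppLK e1 K) mk)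
| step_natop op e0 e1 K mk :
    step (Ceval (NatOp op e0 e1) K mk) (Ceval e1 (NatOpRK op e0 K) mk)
| step_if e0 e1 e2 K mk :
    step (Ceval (If e0 e1 e2) K mk) (Ceval e0 (IfK e1 e2 K) mk)
| step_reset e K mk :
    step (Ceval (Reset e) K mk) (Ceval e EndK (K :: mk))
| step_shift e K mk :
    step (Ceval (Shift e) K mk) (Ceval (subst1 e (ContV K)) EndK mk)
| step_appcont e0 e1 K mk :
    step (Ceval (AppCont e0 e1) K mk) (Ceval e1 (AppContRK e0 K) mk)
| step_endK v mk : step (Ccont EndK v mk) (Cmcont mk v)
| step_appLK e K v mk :
    step (Ccont (AppLK e K) v mk) (Ceval e (AppRK v K) mk)
| step_appRK e K v mk :
    step (Ccont (AppRK (RecV e) K) v mk) (Ceval (subst2 e (RecV e) v) K mk)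
| step_natopRK op e K v mk :
    step (Ccont (NatOpRK op e K) v mk) (Ceval e (NatOpLK op v K) mk)
| step_natopLK op K n0 n1 mk :
    step (Ccont (NatOpLK op (LitV n1) K) (LitV n0) mk)
         (Ccont K (LitV (do_natop op n0 n1)) mk)
| step_ifK_true e1 e2 K n mk :
    n <> 0 -> step (Ccont (IfK e1 e2 K) (LitV n) mk) (Ceval e1 K mk)
| step_ifK_false e1 e2 K mk :
    step (Ccont (IfK e1 e2 K) (LitV 0) mk) (Ceval e2 K mk)
| step_appcontRK e K v mk :
    step (Ccont (AppContRK e K) v mk) (Ceval e (AppContLK v K) mk)
| step_appcontLK K K' v mk :
    step (Ccont (AppContLK v K) (ContV K') mk) (Ccont K' v (K :: mk))
| step_mcont_cons K mk v : step (Cmcont (K :: mk) v) (Ccont K v mk)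
| step_mcont_nil v : step (Cmcont [] v) (Cret v).

Definition steps : config -> config -> Prop := clos_refl_trans config step.

Section IT.
  Variable G : Type.

  Definition IT : cofe := it_car (it_solution_exists G).
  Definition it_fold : nodeC G IT -n> IT := it_in (it_solution_exists G).
  Definition it_unfold : IT -n> nodeC G IT := it_out (it_solution_exists G).

  Lemma it_fold_unfold t : it_fold (it_unfold t) = t.
  Proof. apply it_in_out. Qed.
  Lemma it_unfold_fold t : it_unfold (it_fold t) = t.
  Proof. apply it_out_in. Qed.

  Ltac ne := repeat first
    [ simple apply dist_refl | assumption
    | match goal with
      | |- dist _ (hom_fun it_fold _) (hom_fun it_fold _) =>
        apply hom_ne; first [ assumption | split; first [ assumption | apply dist_refl ] ]
      | |- dist _ (hom_fun _ _) (hom_fun _ _) => apply app_ne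
      | |- dist _ (Next _) (Next _) => apply (hom_ne nextC)
      | |- dist _ (_, _) (_, _) => split; cbn [fst snd]
      | |- dist _ (match ?a with _ => _ end) (match ?a with _ => _ end) => destruct a
      | |- dist _ (Hom _ _) (Hom _ _) => intro; cbn [hom_fun]
      | |- dist _ (compC _ _) (compC _ _) => intro; cbn [hom_fun compC]
      end ].
  #[local] Obligation Tactic := intros; cbn [hom_fun];
    try match goal with H : @dist (discreteC _) _ _ _ |- _ => destruct H end;
    try solve [ne].

  Program Definition Ret : discreteC (nat + G) -n> IT :=
    Hom (fun a => it_fold (RetN a)) _.
  Program Definition Fun : ▷ (IT -n> IT) -n> IT :=
    Hom (fun f => it_fold (FunN f)) _.
  Definition Err : IT := it_fold ErrN.
  Program Definition Tau : ▷ IT -n> IT :=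
    Hom (fun t => it_fold (TauN t)) _.
  Program Definition Vis_shift :
      ((▷ IT -n> ▷ IT) -n> ▷ IT) -n> (▷ IT -n> ▷ IT) -n> IT :=
    Hom (fun x => Hom (fun k => it_fold (ShiftN x k)) _) _.
  Program Definition Vis_reset : ▷ IT -n> (▷ IT -n> ▷ IT) -n> IT :=
    Hom (fun x => Hom (fun k => it_fold (ResetN x k)) _) _.
  Program Definition Vis_pop : ▷ IT -n> (discreteC Empty_set -n> ▷ IT) -n> IT :=
    Hom (fun x => Hom (fun k => it_fold (PopN x k)) _) _.
  Program Definition Vis_appcont :
      prodC (▷ IT) (▷ (IT -n> IT)) -n> (▷ IT -n> ▷ IT) -n> IT :=
    Hom (fun x => Hom (fun k => it_fold (AppcontN x k)) _) _.

  Definition Tick (t : IT) : IT := Tau (Next t).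


  (** [elim_it r f] applies [r] and [f] to the leaves [Ret] and [Fun] and
      commutes with [Err], [Tau] and [Vis]. *)
  Definition elim_it_body (r : discreteC (nat + G) -n> IT) (f : ▷ (IT -n> IT) -n> IT)
      (self : ▷ (IT -n> IT)) (t : IT) : IT :=
    match it_unfold t with
    | RetN a => r a
    | FunN g => f g
    | ErrN => Err
    | TauN u => Tau (lap self u)
    | ShiftN x k => Vis_shift x (compC (lap self) k)
    | ResetN x k => Vis_reset x (compC (lap self) k)
    | PopN x k => Vis_pop x (compC (lap self) k)
    | AppcontN x k => Vis_appcont x (compC (lap self) k)
    end.

  Lemma elim_it_body_ne n r r' f f' self self' t t' :
    dist n r r' -> dist n f f' -> dist n self self' -> dist n t t' ->
    dist n (elim_it_body r f self t) (elim_it_body r' f' self' t').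
  Proof.
    intros Hr Hf Hs Ht. unfold elim_it_body.
    pose proof (hom_ne it_unfold Ht) as Hu.
    assert (Hk : forall (A : cofe) (k k' : A -n> ▷ IT), dist n k k' ->
      dist n (compC (lap self) k) (compC (lap self') k')).
    { intros A k k' Hkk. ne. }
    destruct (it_unfold t) as [a|[g|[[]|[u|[[x k]|[[x k]|[[x k]|[x k]]]]]]]],
      (it_unfold t') as [a'|[g'|[[]|[u'|[[x' k']|[[x' k']|[[x' k']|[x' k']]]]]]]];
      try (destruct Hu; fail).
    - ne.
    - ne.
    - ne.
    - ne.
    - destruct Hu as [Hx Hkk]. apply app_ne; [ne | apply Hk, Hkk].
    - destruct Hu as [Hx Hkk]. apply app_ne; [ne | apply Hk, Hkk].
    - destruct Hu as [Hx Hkk]. apply app_ne; [ne | apply Hk, Hkk].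
    - destruct Hu as [Hx Hkk]. apply app_ne; [ne | apply Hk, Hkk].
  Qed.

  Program Definition elim_it_step r f : ▷ (IT -n> IT) -n> IT -n> IT :=
    Hom (fun self => Hom (elim_it_body r f self) _) _.
  Next Obligation. apply elim_it_body_ne; auto using dist_refl. Qed.
  Next Obligation. intros t; apply elim_it_body_ne; auto using dist_refl. Qed.

  Program Definition elim_it :
      (discreteC (nat + G) -n> IT) -n> (▷ (IT -n> IT) -n> IT) -n> IT -n> IT :=
    Hom (fun r => Hom (fun f => mu (idC : IT -n> IT) (elim_it_step r f)) _) _.
  Next Obligation.
    apply mu_ne; intros self t; apply elim_it_body_ne; auto using dist_refl.
  Qed.
  Next Obligation.
    intros f; apply mu_ne; intros self t; apply elim_it_body_ne; auto using dist_refl.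
  Qed.

  Lemma elim_it_eq r f t : elim_it r f t = elim_it_body r f (Next (elim_it r f)) t.
  Proof. simpl. rewrite mu_eq at 1. reflexivity. Qed.

  Program Definition getval : (IT -n> IT) -n> IT -n> IT :=
    Hom (fun k => elim_it (compC k Ret) (compC k Fun)) _.

  Program Definition getfun : (▷ (IT -n> IT) -n> IT) -n> IT -n> IT :=
    Hom (fun k => elim_it (constC Err) k) _.

  Program Definition getret : (discreteC nat -n> IT) -n> IT -n> IT :=
    Hom (fun k => elim_it
      (Hom (fun a => match a with inl n => k n | inr _ => Err end) _)
      (constC Err)) _.

  (* Evaluates the argument, then the function. *)
  Program Definition APP : IT -n> IT -n> IT :=
    Hom (fun f => Hom (fun x =>
      getval (Hom (fun v => getfun (Hom (fun g => Tau (lap g (Next v))) _) f) _) x) _) _.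

  (* Evaluates the second operand, then the first. *)
  Program Definition NATOP (op : nat -> nat -> nat) : IT -n> IT -n> IT :=
    Hom (fun t1 => Hom (fun t2 =>
      getval (Hom (fun v2 =>
        getval (Hom (fun v1 =>
          getret (Hom (fun n1 =>
            getret (Hom (fun n2 => Ret (inl (op n1 n2))) _) v2) _) v1) _) t1) _) t2) _) _.

  Program Definition IF : IT -n> IT -n> IT -n> IT :=
    Hom (fun t => Hom (fun t1 => Hom (fun t2 =>
      getret (Hom (fun n => match n with 0 => t2 | S _ => t1 end) _) t) _) _) _.

  Definition stack : Type := list (▷ IT -n> ▷ IT).

  Definition r_reset (e : ▷ IT) (σ : stack) (κ : ▷ IT -n> ▷ IT) :
    option (▷ IT * stack) := Some (e, κ :: σ).
  Definition r_shift (f : (▷ IT -n> ▷ IT) -n> ▷ IT) (σ : stack) (κ : ▷ IT -n> ▷ IT) :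
    option (▷ IT * stack) := Some (f κ, σ).
  Definition r_pop (e : ▷ IT) (σ : stack) (_ : discreteC Empty_set -n> ▷ IT) :
    option (▷ IT * stack) :=
    match σ with
    | [] => Some (e, [])
    | κ :: σ => Some (κ e, σ)
    end.
  Definition r_appcont (x : prodC (▷ IT) (▷ (IT -n> IT))) (σ : stack)
    (κ' : ▷ IT -n> ▷ IT) : option (▷ IT * stack) :=
    let (e, κ) := x in Some (lap κ e, κ' :: σ).

  Inductive red : IT * stack -> IT * stack -> Prop :=
  | red_tick α β σ σ' : α = Tick β -> σ' = σ -> red (α, σ) (β, σ')
  | red_shift α β σ σ' x k :
      α = Vis_shift x k -> r_shift x σ k = Some (Next β, σ') -> red (α, σ) (β, σ')
  | red_reset α β σ σ' x k :
      α = Vis_reset x k -> r_reset x σ k = Some (Next β, σ') -> red (α, σ) (β, σ')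
  | red_pop α β σ σ' x k :
      α = Vis_pop x k -> r_pop x σ k = Some (Next β, σ') -> red (α, σ) (β, σ')
  | red_appcont α β σ σ' x k :
      α = Vis_appcont x k -> r_appcont x σ k = Some (Next β, σ') -> red (α, σ) (β, σ').

  Program Definition SHIFT : ((▷ IT -n> ▷ IT) -n> IT) -n> IT :=
    Hom (fun f => Vis_shift (compC nextC f) idC) _.
  Program Definition RESET : IT -n> IT := Hom (fun e => Vis_reset (Next e) idC) _.
  Program Definition POP : IT -n> IT :=
    Hom (fun e => Vis_pop (Next e)
      (Hom (fun x : discreteC Empty_set => match x return ▷ IT with end) _)) _.
  Program Definition APPCONT : ▷ IT -n> ▷ (IT -n> IT) -n> IT :=
    Hom (fun x => Hom (fun y => Vis_appcont (x, y) idC) _) _.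

  Definition popAux : IT -n> IT := getval POP.

  Program Definition RESUME : IT -n> IT -n> IT :=
    Hom (fun t1 => Hom (fun t2 =>
      getval (Hom (fun x => getfun (Hom (fun y => APPCONT (Next x) y) _) t1) _) t2) _) _.

  (* The meaning of [e1 e2]. [APP] alone would evaluate [e2] first, against
     [typed_app] and the machine. *)
  Program Definition APPL : IT -n> IT -n> IT :=
    Hom (fun t1 => Hom (fun t2 => getval (Hom (fun f => APP f t2) _) t1) _) _.

  Definition envC (X : Set) : cofe := piC X IT.

  Lemma extend_ne (X : Set) n (ρ ρ' : envC X) (t t' : IT) :
    dist n ρ ρ' -> dist n t t' ->
    @dist (envC (option X)) n (extend ρ t) (extend ρ' t').
  Proof. intros Hρ Ht [x|]; simpl; auto. Qed.

  Ltac ne_env := repeat first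
    [ progress ne
    | match goal with
      | |- dist _ (extend _ _) (extend _ _) => apply extend_ne
      end ].
  #[local] Obligation Tactic := intros; cbn [hom_fun]; try solve [ne_env].

  Program Definition den_var {X : Set} (x : X) : envC X -n> IT :=
    Hom (fun ρ : envC X => ρ x) _.
  Next Obligation. apply H. Qed.

  Program Definition den_op {X : Set} (op : IT -n> IT -n> IT) (t1 t2 : envC X -n> IT) :
      envC X -n> IT :=
    Hom (fun ρ => op (t1 ρ) (t2 ρ)) _.

  Program Definition den_if {X : Set} (t1 t2 t3 : envC X -n> IT) : envC X -n> IT :=
    Hom (fun ρ => IF (t1 ρ) (t2 ρ) (t3 ρ)) _.

  Program Definition den_reset {X : Set} (t : envC X -n> IT) : envC X -n> IT :=
    Hom (fun ρ => RESET (popAux (t ρ))) _.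

  Program Definition shift_body {X : Set} (t : envC (option X) -n> IT) :
      envC X -n> (▷ IT -n> ▷ IT) -n> IT :=
    Hom (fun ρ => Hom (fun κ =>
      t (extend ρ (Fun (Next (Hom (fun y => Tau (κ (Next y))) _))))) _) _.

  Program Definition den_shift {X : Set} (t : envC (option X) -n> IT) : envC X -n> IT :=
    Hom (fun ρ => SHIFT (compC popAux (shift_body t ρ))) _.

  Program Definition rec_body {X : Set} (t : envC (option (option X)) -n> IT) :
      envC X -n> IT -n> IT -n> IT :=
    Hom (fun ρ => Hom (fun f => Hom (fun x => t (extend (extend ρ f) x)) _) _) _.

  Program Definition den_rec {X : Set} (t : envC (option (option X)) -n> IT) :
      envC X -n> IT :=
    Hom (fun ρ => mu Err (compC Fun (lmap (rec_body t ρ)))) _.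
  Next Obligation. apply mu_ne. unfold lmap. ne_env. Qed.

  Lemma den_rec_eq (X : Set) (t : envC (option (option X)) -n> IT) ρ :
    den_rec t ρ = Fun (Next (rec_body t ρ (den_rec t ρ))).
  Proof. apply (mu_eq Err (compC Fun (lmap (rec_body t ρ)))). Qed.

  Program Definition den_contv {X : Set} (K : envC X -n> IT -n> IT) : envC X -n> IT :=
    Hom (fun ρ => Fun (Next (Hom (fun x => Tick (popAux (K ρ x))) _))) _.
  Next Obligation. unfold Tick. ne_env. Qed.
  Next Obligation. unfold Tick. ne_env. Qed.

  Program Definition frameL {X : Set} (op : IT -n> IT -n> IT) (t : envC X -n> IT)
      (K : envC X -n> IT -n> IT) : envC X -n> IT -n> IT :=
    Hom (fun ρ => Hom (fun x => K ρ (op x (t ρ))) _) _.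
  Program Definition frameR {X : Set} (op : IT -n> IT -n> IT) (t : envC X -n> IT)
      (K : envC X -n> IT -n> IT) : envC X -n> IT -n> IT :=
    Hom (fun ρ => Hom (fun x => K ρ (op (t ρ) x)) _) _.
  Program Definition frame_if {X : Set} (t1 t2 : envC X -n> IT)
      (K : envC X -n> IT -n> IT) : envC X -n> IT -n> IT :=
    Hom (fun ρ => Hom (fun x => K ρ (IF x (t1 ρ) (t2 ρ))) _) _.

  Fixpoint den {X : Set} (e : expr X) : envC X -n> IT :=
    match e with
    | Val v => den_val v
    | Var x => den_var x
    | App e1 e2 => den_op APPL (den e1) (den e2)
    | NatOp op e1 e2 => den_op (NATOP (do_natop op)) (den e1) (den e2)
    | If e1 e2 e3 => den_if (den e1) (den e2) (den e3)
    | Shift e => den_shift (den e)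
    | Reset e => den_reset (den e)
    | AppCont e1 e2 => den_op RESUME (den e1) (den e2)
    end
  with den_val {X : Set} (v : val X) : envC X -n> IT :=
    match v with
    | LitV n => constC (Ret (inl n))
    | RecV e => den_rec (den e)
    | ContV K => den_contv (den_ctx K)
    end
  with den_ctx {X : Set} (K : ctx X) : envC X -n> IT -n> IT :=
    match K with
    | EndK => constC idC
    | AppLK e K => frameL APPL (den e) (den_ctx K)
    | AppRK v K => frameR APPL (den_val v) (den_ctx K)
    | NatOpLK op v K => frameL (NATOP (do_natop op)) (den_val v) (den_ctx K)
    | NatOpRK op e K => frameR (NATOP (do_natop op)) (den e) (den_ctx K)
    | IfK e1 e2 K => frame_if (den e1) (den e2) (den_ctx K)
    | AppContLK v K => frameL RESUME (den_val v) (den_ctx K)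
    | AppContRK e K => frameR RESUME (den e) (den_ctx K)
    end.
End IT.

Arguments Err {G}.

(* Main.v *)
(** A logical relation between guarded interaction trees and the abstract machine,
    indexed by the number of reductions of the tree still to be observed. Semantic
    types are CPS types: in [Γ; α ⊢ e : τ; β] the expression is run in a context that
    turns [τ] into the answer type [α] and under a metacontinuation that accepts [β].
    Contexts denote homomorphisms, i.e. they commute with [Tau] and [Vis], so an
    effect under a context captures exactly [popAux] after the context, which is the
    entry the machine pushes on the metacontinuation. As reduction is deterministic,
    each observed tree reduction can be matched by machine steps; recursive functions
    are handled by induction on the index, since application costs one [Tick]. *)

Require Import Defs.
From Stdlib Require Import List Relations Lia FunctionalExtensionality.
Import ListNotations.

(* Mutual induction over syntax and typing *)
Scheme expr_mut := Induction for expr Sort Prop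
  with val_mut := Induction for val Sort Prop
  with ctx_mut := Induction for ctx Sort Prop.
Combined Scheme syntax_mutind from expr_mut, val_mut, ctx_mut.

Scheme typed_mut := Induction for typed Sort Prop
  with ptyped_mut := Induction for ptyped Sort Prop.
Combined Scheme typed_ptyped_mutind from typed_mut, ptyped_mut.

(** Binders change the set of variables, so the three motives must range over all [X]; they are read
    off the three conjuncts of the goal. *)
Ltac syntax_induction X :=
  revert X;
  match goal with
  | |- forall X, (forall e, @?P X e) /\ (forall v, @?Q X v) /\ (forall K, @?R X K) =>
    apply (syntax_mutind P Q R)
  end.

(** * Substitution *)

Lemma ren_ren (X : Set) :
  (forall (e : expr X) (Y Z : Set) (r : X -> Y) (q : Y -> Z),
    ren_expr q (ren_expr r e) = ren_expr (fun x => q (r x)) e) /\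
  (forall (v : val X) (Y Z : Set) (r : X -> Y) (q : Y -> Z),
    ren_val q (ren_val r v) = ren_val (fun x => q (r x)) v) /\
  (forall (K : ctx X) (Y Z : Set) (r : X -> Y) (q : Y -> Z),
    ren_ctx q (ren_ctx r K) = ren_ctx (fun x => q (r x)) K).
Proof.
  syntax_induction X; intros; simpl; f_equal; auto;
    rewrite H; f_equal; extensionality o;
    repeat (destruct o as [o|]; [| reflexivity]); reflexivity.
Qed.

Lemma lift_ren (X Y Z : Set) (r : X -> Y) (s : Y -> expr Z) :
  (fun o => lift s (option_map r o)) = lift (fun x => s (r x)).
Proof. extensionality o; destruct o; reflexivity. Qed.

Lemma subst_ren (X : Set) :
  (forall (e : expr X) (Y Z : Set) (r : X -> Y) (s : Y -> expr Z),
    subst_expr s (ren_expr r e) = subst_expr (fun x => s (r x)) e) /\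
  (forall (v : val X) (Y Z : Set) (r : X -> Y) (s : Y -> expr Z),
    subst_val s (ren_val r v) = subst_val (fun x => s (r x)) v) /\
  (forall (K : ctx X) (Y Z : Set) (r : X -> Y) (s : Y -> expr Z),
    subst_ctx s (ren_ctx r K) = subst_ctx (fun x => s (r x)) K).
Proof.
  syntax_induction X; intros; simpl; f_equal; auto;
    rewrite H, ?lift_ren; reflexivity.
Qed.

Lemma ren_lift (X Y Z : Set) (s : X -> expr Y) (r : Y -> Z) :
  (fun o => ren_expr (option_map r) (lift s o)) = lift (fun x => ren_expr r (s x)).
Proof.
  extensionality o; destruct o as [x|]; [| reflexivity].
  simpl. rewrite !(proj1 (ren_ren _)). reflexivity.
Qed.

Lemma ren_subst (X : Set) :
  (forall (e : expr X) (Y Z : Set) (s : X -> expr Y) (r : Y -> Z),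
    ren_expr r (subst_expr s e) = subst_expr (fun x => ren_expr r (s x)) e) /\
  (forall (v : val X) (Y Z : Set) (s : X -> expr Y) (r : Y -> Z),
    ren_val r (subst_val s v) = subst_val (fun x => ren_expr r (s x)) v) /\
  (forall (K : ctx X) (Y Z : Set) (s : X -> expr Y) (r : Y -> Z),
    ren_ctx r (subst_ctx s K) = subst_ctx (fun x => ren_expr r (s x)) K).
Proof.
  syntax_induction X; intros; simpl; f_equal; auto;
    rewrite H, ?ren_lift; reflexivity.
Qed.

Lemma subst_lift (X Y Z : Set) (s : X -> expr Y) (s' : Y -> expr Z) :
  (fun o => subst_expr (lift s') (lift s o)) = lift (fun x => subst_expr s' (s x)).
Proof.
  extensionality o; destruct o as [x|]; [| reflexivity].
  simpl. rewrite (proj1 (subst_ren _)), (proj1 (ren_subst _)). reflexivity.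
Qed.

(** [lift] weakens by a renaming, so fusing two substitutions under a binder rests on the laws that
    mix renaming and substitution. *)
Lemma subst_subst (X : Set) :
  (forall (e : expr X) (Y Z : Set) (s : X -> expr Y) (s' : Y -> expr Z),
    subst_expr s' (subst_expr s e) = subst_expr (fun x => subst_expr s' (s x)) e) /\
  (forall (v : val X) (Y Z : Set) (s : X -> expr Y) (s' : Y -> expr Z),
    subst_val s' (subst_val s v) = subst_val (fun x => subst_expr s' (s x)) v) /\
  (forall (K : ctx X) (Y Z : Set) (s : X -> expr Y) (s' : Y -> expr Z),
    subst_ctx s' (subst_ctx s K) = subst_ctx (fun x => subst_expr s' (s x)) K).
Proof.
  syntax_induction X; intros; simpl; f_equal; auto;
    rewrite H, ?subst_lift; reflexivity.
Qed.

Lemma lift_Var (X : Set) : lift (@Var X) = @Var (option X).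
Proof. extensionality o; destruct o; reflexivity. Qed.

Lemma subst_Var (X : Set) :
  (forall (e : expr X), subst_expr (@Var X) e = e) /\
  (forall (v : val X), subst_val (@Var X) v = v) /\
  (forall (K : ctx X), subst_ctx (@Var X) K = K).
Proof.
  syntax_induction X; intros; simpl; f_equal; rewrite ?lift_Var; auto.
Qed.

(** The substitution made by the machine cancels the weakening in [lift]. This turns its result into
    the form on which an induction hypothesis about closing substitutions applies. *)
Lemma subst1_lift (X Y : Set) (γ : X -> val Y) (v : val Y) (e : expr (option X)) :
  subst1 (subst_expr (lift (fun x => Val (γ x))) e) v =
  subst_expr (fun x => Val (extend γ v x)) e.
Proof.
  unfold subst1. rewrite (proj1 (subst_subst _)). f_equal.
  extensionality o; destruct o as [x|]; [| reflexivity].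
  simpl. rewrite (proj1 (proj2 (subst_ren _))). f_equal. apply subst_Var.
Qed.

Lemma subst2_lift (X Y : Set) (γ : X -> val Y) (v w : val Y)
    (e : expr (option (option X))) :
  subst2 (subst_expr (lift (lift (fun x => Val (γ x)))) e) v w =
  subst_expr (fun x => Val (extend (extend γ v) w x)) e.
Proof.
  unfold subst2. rewrite (proj1 (subst_subst _)). f_equal.
  extensionality o; destruct o as [[x|]|]; [| reflexivity ..].
  simpl. rewrite !(proj1 (proj2 (subst_ren _))). f_equal. apply subst_Var.
Qed.

(** * Reduction of guarded interaction trees *)

(** [it_unfold] is a left inverse. The solution itself is opaque, so injectivity and disjointness of
    all tree constructors come from here. *)
Lemma it_fold_inj (G : Type) (x y : nodeC G (IT G)) : it_fold G x = it_fold G y -> x = y.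
Proof. intros H. rewrite <- (it_unfold_fold x), <- (it_unfold_fold y), H. reflexivity. Qed.

(** The head constructor selects the rule, and each reifier is a function of its arguments. *)
Lemma red_det (G : Type) (a b b' : IT G * stack G) : red a b -> red a b' -> b = b'.
Proof.
  intros H H'; inversion H; subst; inversion H'; subst;
    match goal with
    | E : _ = _ :> car (IT G) |- _ => apply it_fold_inj in E; try discriminate E; injection E
    end; intros; subst;
    repeat match goal with
    | x : car (prodC _ _) |- _ => destruct x
    | E : r_pop _ ?s _ = _ |- _ => is_var s; destruct s
    end;
    unfold r_shift, r_reset, r_pop, r_appcont in *; congruence.
Qed.

Lemma red_Ret (G : Type) (x : nat + G) (σ : stack G) b : ~ red (Ret G x, σ) b.
Proof.
  intros H; inversion H; subst;
    match goal with
    | E : _ = _ :> car (IT G) |- _ => apply it_fold_inj in E; discriminate E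
    end.
Qed.

Fixpoint redn {G : Type} (j : nat) (a b : IT G * stack G) : Prop :=
  match j with
  | 0 => a = b
  | S j => exists c, red a c /\ redn j c b
  end.

Lemma clos_redn (G : Type) (a b : IT G * stack G) :
  clos_refl_trans _ (@red G) a b -> exists j, redn j a b.
Proof.
  intros H. apply clos_rt_rt1n in H. induction H as [|a c b Hac _ [j Hj]].
  - exists 0; reflexivity.
  - exists (S j), c; auto.
Qed.

(** * Homomorphisms and the reductions under them *)

Record it_hom {G : Type} (h : IT G -n> IT G) : Prop := {
  hom_Tau : forall u, h (Tau G u) = Tau G (lmap h u);
  hom_shift : forall x k, h (Vis_shift G x k) = Vis_shift G x (compC (lmap h) k);
  hom_reset : forall x k, h (Vis_reset G x k) = Vis_reset G x (compC (lmap h) k);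
  hom_appcont : forall x k, h (Vis_appcont G x k) = Vis_appcont G x (compC (lmap h) k) }.

Lemma elim_it_hom (G : Type) r f : it_hom (elim_it G r f).
Proof.
  (* One unfolding is enough: the recursive occurrence stays under [Next], and [lap (Next h)] is
     [lmap h] by definition. *)
  split; intros; rewrite elim_it_eq at 1; unfold elim_it_body;
    cbn [hom_fun Tau Vis_shift Vis_reset Vis_appcont]; rewrite it_unfold_fold; reflexivity.
Qed.

Lemma elim_it_Ret (G : Type) r f a : elim_it G r f (Ret G a) = r a.
Proof.
  rewrite elim_it_eq; unfold elim_it_body; cbn [hom_fun Ret].
  rewrite it_unfold_fold; reflexivity.
Qed.

Lemma elim_it_Fun (G : Type) r f g : elim_it G r f (Fun G g) = f g.
Proof.
  rewrite elim_it_eq; unfold elim_it_body; cbn [hom_fun Fun].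
  rewrite it_unfold_fold; reflexivity.
Qed.

Lemma lmap_idC (A : cofe) : lmap (idC : A -n> A) = idC.
Proof. apply hom_ext; intros []; reflexivity. Qed.

Lemma compC_idC_l (A B : cofe) (f : A -n> B) : compC idC f = f.
Proof. apply hom_ext; reflexivity. Qed.

Lemma compC_idC_r (A B : cofe) (f : A -n> B) : compC f idC = f.
Proof. apply hom_ext; reflexivity. Qed.

Lemma idC_hom (G : Type) : it_hom (idC : IT G -n> IT G).
Proof. split; intros; rewrite lmap_idC, ?compC_idC_l; reflexivity. Qed.

Lemma compC_lmap (A B C D : cofe) (g : C -n> D) (f : B -n> C) (k : A -n> ▷ B) :
  compC (lmap g) (compC (lmap f) k) = compC (lmap (compC g f)) k.
Proof. apply hom_ext; reflexivity. Qed.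

(** The pointwise equation lets a context built from a frame count as a composite even when it is
    one only after simplification by a value. *)
Lemma comp_hom (G : Type) (κ h κ' : IT G -n> IT G) :
  it_hom κ -> it_hom h -> (forall t, κ' t = κ (h t)) -> it_hom κ'.
Proof.
  intros Hκ Hh E.
  assert (κ' = compC κ h) as -> by (apply hom_ext; exact E).
  split; intros; cbn [hom_fun compC].
  - rewrite (hom_Tau _ Hh), (hom_Tau _ Hκ). reflexivity.
  - rewrite (hom_shift _ Hh), (hom_shift _ Hκ), compC_lmap. reflexivity.
  - rewrite (hom_reset _ Hh), (hom_reset _ Hκ), compC_lmap. reflexivity.
  - rewrite (hom_appcont _ Hh), (hom_appcont _ Hκ), compC_lmap. reflexivity.
Qed.

Lemma popAux_hom (G : Type) (κ : IT G -n> IT G) :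
  it_hom κ -> it_hom (compC (popAux G) κ).
Proof.
  intros H. apply (comp_hom _ (popAux G) κ); auto. apply elim_it_hom.
Qed.

Lemma red_hom_Tick (G : Type) (h : IT G -n> IT G) u σ :
  it_hom h -> red (h (Tick u), σ) (h u, σ).
Proof.
  intros H. apply red_tick; [| reflexivity]. unfold Tick at 1. rewrite (hom_Tau _ H).
  reflexivity.
Qed.

(** The effect carries the identity continuation, so after commuting with [h] the continuation
    handed to the reifier is exactly [lmap h]. *)
Lemma red_hom_RESET (G : Type) (h : IT G -n> IT G) u σ :
  it_hom h -> red (h (RESET G u), σ) (u, lmap h :: σ).
Proof.
  intros H. eapply red_reset; [apply (hom_reset _ H) |].
  rewrite compC_idC_r. reflexivity.
Qed.

Lemma red_hom_SHIFT (G : Type) (h : IT G -n> IT G) f σ :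
  it_hom h -> red (h (SHIFT G f), σ) (f (lmap h), σ).
Proof.
  intros H. eapply red_shift; [apply (hom_shift _ H) |].
  rewrite compC_idC_r. reflexivity.
Qed.

Lemma red_hom_APPCONT (G : Type) (h : IT G -n> IT G) x g σ :
  it_hom h -> red (h (APPCONT G (Next x) (Next g)), σ) (g x, lmap h :: σ).
Proof.
  intros H. eapply red_appcont; [apply (hom_appcont _ H) |].
  rewrite compC_idC_r. reflexivity.
Qed.

Lemma red_POP_nil (G : Type) (t : IT G) : red (POP G t, []) (t, []).
Proof. eapply red_pop; reflexivity. Qed.

Lemma red_POP_cons (G : Type) (h : IT G -n> IT G) t σ :
  red (POP G t, lmap h :: σ) (h t, σ).
Proof. eapply red_pop; reflexivity. Qed.

Variant it_val {G : Type} : IT G -> Prop :=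
| it_val_Ret a : it_val (Ret G a)
| it_val_Fun g : it_val (Fun G g).

Lemma getval_val (G : Type) (k : IT G -n> IT G) t : it_val t -> getval G k t = k t.
Proof. intros []; [apply elim_it_Ret | apply elim_it_Fun]. Qed.

Lemma getret_Ret (G : Type) (k : discreteC nat -n> IT G) n :
  getret G k (Ret G (inl n)) = k n.
Proof. apply elim_it_Ret. Qed.

Lemma getfun_Fun (G : Type) (k : ▷ (IT G -n> IT G) -n> IT G) g :
  getfun G k (Fun G g) = k g.
Proof. apply elim_it_Fun. Qed.

(** * The logical relation *)

(** Only runs of at most [k] reductions that end in a number are observed; a stuck or longer run
    imposes nothing on the machine. *)
Definition obs {G : Type} (k : nat) (a : IT G * stack G) (c : config) : Prop :=
  forall j n σ, j <= k -> redn j a (Ret G (inl n), σ) -> steps c (Cret (LitV n)).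

Lemma obs_step (G : Type) k (a : IT G * stack G) c c' :
  step c c' -> obs k a c' -> obs k a c.
Proof.
  intros H Ho j n σ Hj Hr. eapply rt_trans; [apply rt_step, H | eapply Ho; eauto].
Qed.

(** Determinism forces every observed run to begin with the given reduction, which uses up one unit
    of the index; an empty run would end in an irreducible [Ret]. *)
Lemma obs_red (G : Type) k (a b : IT G * stack G) c :
  red a b -> (forall j, j < k -> obs j b c) -> obs k a c.
Proof.
  intros Hab Ho [|j] n σ Hj Hr.
  - simpl in Hr; subst a. destruct (red_Ret _ _ _ _ Hab).
  - destruct Hr as (b' & Hab' & Hr). rewrite (red_det _ _ _ _ Hab' Hab) in Hr.
    eapply Ho; eauto.
Qed.

(* [krel A B] are contexts taking [A] to the answer type [B]; [mrel A] are
   metacontinuations awaiting [A]. *)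
Definition rel (G : Type) : Type := nat -> IT G -> cval -> Prop.

Definition mrel {G : Type} (A : rel G) (k : nat) (σ : stack G) (mk : mctx) : Prop :=
  forall j t v, j <= k -> A j t v -> obs j (POP G t, σ) (Cmcont mk v).

Definition krel {G : Type} (A B : rel G) (k : nat) (κ : IT G -n> IT G) (K : cctx) : Prop :=
  it_hom κ /\
  forall j t v σ mk, j <= k -> A j t v -> mrel B j σ mk ->
    obs j (popAux G (κ t), σ) (Ccont K v mk).

(** Recursion is on the type alone, which is why [krel] and [mrel] take relations as parameters. A
    continuation value keeps its context [κ], of which the tree is the delayed and delimited
    form. *)
Fixpoint vrel {G : Type} (τ : ty) (k : nat) (t : IT G) (v : cval) : Prop :=
  match τ with
  | Tnat => exists n, t = Ret G (inl n) /\ v = LitV n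
  (* The index drops strictly, which is what makes [RecV] related to itself. *)
  | Tarr τ α σ β => exists g : IT G -n> IT G,
      t = Fun G (Next g) /\
      forall j t' v' κ K s mk, j < k -> vrel τ j t' v' ->
        krel (vrel σ) (vrel α) j κ K -> mrel (vrel β) j s mk ->
        obs j (popAux G (κ (g t')), s) (Ccont (AppRK v K) v' mk)
  | Tcont τ α => exists (g κ : IT G -n> IT G) K,
      t = Fun G (Next g) /\ v = ContV K /\
      (forall x, g x = Tick (popAux G (κ x))) /\
      krel (vrel τ) (vrel α) k κ K
  end.

(** Orthogonality in CPS form: [A] is the type of the result, [B] the answer type of the context,
    [C] what the metacontinuation accepts. *)
Definition erel {G : Type} (A B C : rel G) (k : nat) (t : IT G) (e : cexpr) : Prop :=
  forall j κ K σ mk, j <= k -> krel A B j κ K -> mrel C j σ mk ->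
    obs j (popAux G (κ t), σ) (Ceval e K mk).

Lemma mrel_le (G : Type) (A : rel G) j k σ mk : j <= k -> mrel A k σ mk -> mrel A j σ mk.
Proof. intros H Hm i t v Hi. apply Hm. lia. Qed.

Lemma krel_le (G : Type) (A B : rel G) j k κ K : j <= k -> krel A B k κ K -> krel A B j κ K.
Proof. intros H [Hh Hk]. split; auto. intros i t v σ mk Hi. apply Hk. lia. Qed.

Lemma vrel_le (G : Type) τ j k (t : IT G) v : j <= k -> vrel τ k t v -> vrel τ j t v.
Proof.
  intros H. destruct τ; simpl; auto.
  - intros (g & -> & Hg). exists g. split; auto. intros i **. apply Hg; auto. lia.
  - intros (g & κ & K & -> & -> & Hg & HK). exists g, κ, K.
    eauto 6 using krel_le.
Qed.

Lemma vrel_val (G : Type) τ k (t : IT G) v : vrel τ k t v -> it_val t.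
Proof.
  destruct τ; simpl.
  - intros (n & -> & _). constructor.
  - intros (g & -> & _). constructor.
  - intros (g & κ & K & -> & _). constructor.
Qed.

Lemma krel_id (G : Type) τ k : krel (@vrel G τ) (vrel τ) k idC EndK.
Proof.
  split; [apply idC_hom |]. intros j t v σ mk Hj Ht Hm.
  eapply obs_step; [apply step_endK |]. unfold popAux; cbn [hom_fun idC].
  rewrite getval_val by (eapply vrel_val; eauto). apply Hm; auto.
Qed.

Lemma mrel_nil (G : Type) k : mrel (@vrel G Tnat) k [] [].
Proof.
  intros j t v Hj (n & -> & ->).
  eapply obs_red; [apply red_POP_nil |].
  (* After the pop the tree is an irreducible [Ret], so the observed number is the returned one. *)
  intros _ _ [|i] m σ _ Hr; simpl in Hr.
  - injection Hr as E _. apply it_fold_inj in E. injection E as ->.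
    apply rt_step, step_mcont_nil.
  - destruct Hr as (c & Hr & _). destruct (red_Ret _ _ _ _ Hr).
Qed.

(** Popping the entry resumes [κ] under its own [popAux], as the machine resumes [K] from the
    metacontinuation. *)
Lemma mrel_cons (G : Type) α β k κ K (σ : stack G) mk :
  krel (vrel α) (vrel β) k κ K -> mrel (vrel β) k σ mk ->
  mrel (vrel α) k (lmap (compC (popAux G) κ) :: σ) (K :: mk).
Proof.
  intros [_ HK] Hm j t v Hj Ht.
  eapply obs_step; [apply step_mcont_cons |].
  eapply obs_red; [apply red_POP_cons |]. intros i Hi.
  apply HK; [lia | eapply vrel_le; [| exact Ht]; lia | eapply mrel_le; [| exact Hm]; lia].
Qed.

(** * Compatibility with the typing rules *)

Lemma erel_val (G : Type) τ α k (t : IT G) v :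
  vrel τ k t v -> erel (vrel τ) (vrel α) (vrel α) k t (Val v).
Proof.
  intros Ht j κ K σ mk Hj [_ HK] Hm.
  eapply obs_step; [apply step_val |]. apply HK; auto. eapply vrel_le; eauto.
Qed.

Lemma erel_reset (G : Type) τ σ α k (t : IT G) e :
  erel (vrel τ) (vrel τ) (vrel σ) k t e ->
  erel (vrel σ) (vrel α) (vrel α) k (RESET G (popAux G t)) (Reset e).
Proof.
  intros He j κ K s mk Hj HK Hm.
  eapply obs_step; [apply step_reset |].
  eapply obs_red; [apply (red_hom_RESET _ (compC (popAux G) κ)), popAux_hom, HK |].
  (* The body starts in the empty context; the surrounding one has moved to the stack. *)
  intros i Hi. apply (He i idC); [lia | apply krel_id |].
  eapply mrel_cons; [eapply krel_le; [| exact HK] | eapply mrel_le; [| exact Hm]]; lia.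
Qed.

(** The captured context is known only when the effect runs, so the premise on the body ranges over
    all related contexts. *)
Lemma erel_shift (G : Type) τ α σ β k (f : (▷ IT G -n> ▷ IT G) -n> IT G) e :
  (forall j κ K, j <= k -> krel (vrel τ) (vrel α) j κ K ->
    erel (vrel σ) (vrel σ) (vrel β) j (f (lmap (compC (popAux G) κ)))
      (subst1 e (ContV K))) ->
  erel (vrel τ) (vrel α) (vrel β) k (SHIFT G (compC (popAux G) f)) (Shift e).
Proof.
  intros He j κ K s mk Hj HK Hm.
  eapply obs_step; [apply step_shift |].
  eapply obs_red; [apply (red_hom_SHIFT _ (compC (popAux G) κ)), popAux_hom, HK |].
  intros i Hi. apply (He j κ K Hj HK i idC); [lia | apply krel_id |].
  eapply mrel_le; [| exact Hm]; lia.
Qed.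

Lemma erel_app (G : Type) σ α τ β γ δ k (t1 t2 : IT G) e1 e2 :
  erel (vrel (Tarr σ α τ β)) (vrel γ) (vrel δ) k t1 e1 ->
  erel (vrel σ) (vrel β) (vrel γ) k t2 e2 ->
  erel (vrel τ) (vrel α) (vrel δ) k (APPL G t1 t2) (App e1 e2).
Proof.
  intros H1 H2 j κ K s mk Hj HK Hm.
  eapply obs_step; [apply step_app |].
  (* The extended context is a frame over the empty variable set, with constant denotations for its
     parts. *)
  apply (H1 j (frameL (X := Empty_set) (APPL G) (constC t2) (constC κ) empty_map)); auto.
  split; [eapply comp_hom; [apply HK | apply elim_it_hom | reflexivity] |].
  clear s mk Hm. intros i t v s mk Hi Ht Hm.
  eapply obs_step; [apply step_appLK |].
  apply (H2 i (frameR (X := Empty_set) (APPL G) (constC t) (constC κ) empty_map));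
    [lia | | exact Hm].
  (* Once the function is a value, [APPL] leaves only the argument to be forced, so the second frame
     is again a homomorphism. *)
  assert (E : forall x, APPL G t x = APP G t x).
  { intros x. apply (getval_val _ (Hom (fun f => APP G f x) _)). eapply vrel_val; eauto. }
  split.
  { eapply comp_hom; [apply HK | apply elim_it_hom |].
    intros x. cbn [hom_fun frameR constC]. rewrite E. reflexivity. }
  clear s mk Hm. intros l t' v' s mk Hl Ht' Hm. cbn [hom_fun frameR constC]. rewrite E.
  destruct Ht as (g & -> & Hg).
  assert (APP G (Fun G (Next g)) t' = Tick (g t')) as ->.
  { cbn [hom_fun APP]. rewrite getval_val by (eapply vrel_val; eauto).
    apply getfun_Fun. }
  (* This [Tick] provides the strict drop of the index demanded by the arrow clause of [vrel]. *)
  eapply obs_red; [apply (red_hom_Tick _ (compC (popAux G) κ)), popAux_hom, HK |].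
  intros l' Hl'. apply Hg; [lia | eapply vrel_le; [| eauto]; lia
    | eapply krel_le; [| eauto]; lia | eapply mrel_le; [| eauto]; lia].
Qed.

Lemma erel_natop (G : Type) op α β σ k (t1 t2 : IT G) e1 e2 :
  erel (vrel Tnat) (vrel α) (vrel β) k t1 e1 ->
  erel (vrel Tnat) (vrel β) (vrel σ) k t2 e2 ->
  erel (vrel Tnat) (vrel α) (vrel σ) k (NATOP G (do_natop op) t1 t2) (NatOp op e1 e2).
Proof.
  intros H1 H2 j κ K s mk Hj HK Hm.
  eapply obs_step; [apply step_natop |].
  apply (H2 j (frameR (X := Empty_set) (NATOP G (do_natop op))
    (constC t1) (constC κ) empty_map)); auto.
  split; [eapply comp_hom; [apply HK | apply elim_it_hom | reflexivity] |].
  clear s mk Hm. intros i t v s mk Hi (n2 & -> & ->) Hm.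
  eapply obs_step; [apply step_natopRK |].
  apply (H1 i (frameL (X := Empty_set) (NATOP G (do_natop op))
    (constC (Ret G (inl n2))) (constC κ) empty_map)); [lia | | exact Hm].
  split.
  (* The second operand is now a value, which leaves a [getval] on the first. *)
  { eapply comp_hom; [apply HK | apply elim_it_hom |].
    intros x. cbn [hom_fun frameL constC NATOP].
    rewrite getval_val by constructor. reflexivity. }
  clear s mk Hm. intros l t v s mk Hl (n1 & -> & ->) Hm.
  eapply obs_step; [apply step_natopLK |].
  assert (frameL (X := Empty_set) (NATOP G (do_natop op)) (constC (Ret G (inl n2)))
    (constC κ) empty_map (Ret G (inl n1)) = κ (Ret G (inl (do_natop op n1 n2)))) as ->.
  { cbn [hom_fun frameL constC NATOP].
    do 2 (rewrite getval_val by constructor; cbn [hom_fun]).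
    do 2 (rewrite getret_Ret; cbn [hom_fun]). reflexivity. }
  apply HK; [lia | exists (do_natop op n1 n2); auto | exact Hm].
Qed.

Lemma erel_if (G : Type) τ α β σ k (t1 t2 t3 : IT G) e1 e2 e3 :
  erel (vrel Tnat) (vrel β) (vrel α) k t1 e1 ->
  erel (vrel τ) (vrel σ) (vrel β) k t2 e2 ->
  erel (vrel τ) (vrel σ) (vrel β) k t3 e3 ->
  erel (vrel τ) (vrel σ) (vrel α) k (IF G t1 t2 t3) (If e1 e2 e3).
Proof.
  intros H1 H2 H3 j κ K s mk Hj HK Hm.
  eapply obs_step; [apply step_if |].
  apply (H1 j (frame_if (X := Empty_set) (constC t2) (constC t3) (constC κ) empty_map)); auto.
  split; [eapply comp_hom; [apply HK | apply elim_it_hom | reflexivity] |].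
  clear s mk Hm. intros i t v s mk Hi (n & -> & ->) Hm.
  assert (frame_if (X := Empty_set) (constC t2) (constC t3) (constC κ) empty_map
    (Ret G (inl n)) = κ (match n with 0 => t3 | S _ => t2 end)) as ->.
  { cbn [hom_fun frame_if constC IF]. rewrite getret_Ret. reflexivity. }
  destruct n as [|n].
  - eapply obs_step; [apply step_ifK_false |].
    apply H3; [lia | eapply krel_le; eauto | exact Hm].
  - eapply obs_step; [apply step_ifK_true; discriminate |].
    apply H2; [lia | eapply krel_le; eauto | exact Hm].
Qed.

Lemma erel_appcont (G : Type) τ α β δ σ k (t1 t2 : IT G) e1 e2 :
  erel (vrel (Tcont τ α)) (vrel σ) (vrel δ) k t1 e1 ->
  erel (vrel τ) (vrel δ) (vrel β) k t2 e2 ->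
  erel (vrel α) (vrel σ) (vrel β) k (RESUME G t1 t2) (AppCont e1 e2).
Proof.
  intros H1 H2 j κ K s mk Hj HK Hm.
  eapply obs_step; [apply step_appcont |].
  apply (H2 j (frameR (X := Empty_set) (RESUME G) (constC t1) (constC κ) empty_map)); auto.
  split; [eapply comp_hom; [apply HK | apply elim_it_hom | reflexivity] |].
  clear s mk Hm. intros i t v s mk Hi Ht Hm.
  eapply obs_step; [apply step_appcontRK |].
  apply (H1 i (frameL (X := Empty_set) (RESUME G) (constC t) (constC κ) empty_map));
    [lia | | exact Hm].
  pose proof (vrel_val _ _ _ _ _ Ht) as Hv.
  split.
  { eapply comp_hom; [apply HK | apply elim_it_hom |].
    intros x. cbn [hom_fun frameL constC RESUME].
    rewrite getval_val by exact Hv. reflexivity. }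
  clear s mk Hm. intros l t' v' s mk Hl (g & κ' & K' & -> & -> & Hg & HK') Hm.
  eapply obs_step; [apply step_appcontLK |].
  assert (frameL (X := Empty_set) (RESUME G) (constC t) (constC κ) empty_map
    (Fun G (Next g)) = κ (APPCONT G (Next t) (Next g))) as ->.
  { cbn [hom_fun frameL constC RESUME]. rewrite getval_val by exact Hv.
    cbn [hom_fun]. rewrite getfun_Fun. reflexivity. }
  (* Two tree reductions, the effect and the [Tick] inside the stored continuation, match the single
     machine step just taken. *)
  eapply obs_red; [apply (red_hom_APPCONT _ (compC (popAux G) κ)), popAux_hom, HK |].
  intros l1 Hl1. rewrite Hg.
  eapply obs_red; [apply red_tick; reflexivity |].
  intros l2 Hl2. apply HK'; [lia | eapply vrel_le; [| eauto]; lia |].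
  eapply mrel_cons; [eapply krel_le; [| exact HK] | eapply mrel_le; [| exact Hm]]; lia.
Qed.

(** * Fundamental lemma and adequacy *)

Definition envrel {G : Type} {X : Set} (Γ : X -> ty) (k : nat) (ρ : envC G X)
    (γ : X -> cval) : Prop :=
  forall x, vrel (Γ x) k (ρ x) (γ x).

Lemma envrel_le (G : Type) (X : Set) (Γ : X -> ty) j k (ρ : envC G X) γ :
  j <= k -> envrel Γ k ρ γ -> envrel Γ j ρ γ.
Proof. intros H Hρ x. eapply vrel_le; eauto. Qed.

Lemma envrel_extend (G : Type) (X : Set) (Γ : X -> ty) τ k (ρ : envC G X) γ t v :
  envrel Γ k ρ γ -> vrel τ k t v ->
  envrel (extend Γ τ) k (extend ρ t : envC G (option X)) (extend γ v).
Proof. intros Hρ Ht [x|]; simpl; auto. Qed.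

Lemma fundamental (G : Type) :
  (forall (X : Set) (Γ : X -> ty) α e τ β, typed Γ α e τ β ->
    forall k (ρ : envC G X) γ, envrel Γ k ρ γ ->
    erel (vrel τ) (vrel α) (vrel β) k (den G e ρ) (subst_expr (fun x => Val (γ x)) e)) /\
  (forall (X : Set) (Γ : X -> ty) e τ, ptyped Γ e τ ->
    forall α k (ρ : envC G X) γ, envrel Γ k ρ γ ->
    erel (vrel τ) (vrel α) (vrel α) k (den G e ρ) (subst_expr (fun x => Val (γ x)) e)).
Proof.
  apply typed_ptyped_mutind.
  - intros; auto.
  - intros X Γ e τ α σ β _ IH k ρ γ Hρ. cbn [subst_expr den den_shift hom_fun].
    (* [σ] is the answer type inside the body and does not occur in the conclusion. *)
    apply (erel_shift _ _ _ σ). intros j κ K Hj HK. rewrite subst1_lift.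
    apply IH, envrel_extend; [eapply envrel_le; eauto |].
    (* The function bound by [shift_body] computes to [Tick (popAux (κ x))] for the captured [κ]. *)
    eexists _, κ, K. split; [reflexivity | split; [reflexivity | split; [| exact HK]]].
    reflexivity.
  - intros; simpl; eapply erel_app; eauto.
  - intros; simpl; eapply erel_if; eauto.
  - intros; simpl; eapply erel_natop; eauto.
  - intros; simpl; eapply erel_appcont; eauto.
  - intros; simpl; eapply erel_reset; eauto.
  - intros X Γ x τ <- α k ρ γ Hρ. apply erel_val, Hρ.
  - intros X Γ e σ α τ β _ IH α' k ρ γ Hρ. apply erel_val.
    (* The body sees the function itself only at smaller indices, where [IHk] relates it. *)
    cbn [subst_val den]. induction k as [k IHk] using (well_founded_induction Wf_nat.lt_wf).
    eexists. split; [apply den_rec_eq |].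
    intros j t v κ K s mk Hj Ht HK Hm.
    eapply obs_step; [apply step_appRK |]. rewrite subst2_lift.
    eapply IH; [| apply le_n | exact HK | exact Hm].
    apply envrel_extend; [apply envrel_extend |]; auto.
    + eapply envrel_le; [| eauto]; lia.
    + apply IHk; auto. eapply envrel_le; [| eauto]; lia.
  - intros X Γ n α k ρ γ Hρ. apply erel_val. exists n; auto.
Qed.

Theorem theorem5p2 (G : Type) (e : expr Empty_set) (n : nat) (σ : stack G)
  (He : typed empty_map Tnat e Tnat Tnat)
  (Hred : clos_refl_trans (IT G * stack G) (@red G)
            (popAux G (den G e empty_map), []) (Ret G (inl n), σ)) :
  steps (Cterm e) (Cret (LitV n)).
Proof.
  destruct (clos_redn _ _ _ Hred) as [k Hk].
  eapply rt_trans; [apply rt_step, step_term |].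
  (* All substitutions out of [Empty_set] are equal, so the closing one is the identity [Var]. *)
  assert (Hs : subst_expr (fun x : Empty_set => Val (@empty_map cval x)) e = e).
  { etransitivity; [| apply (proj1 (subst_Var _))]. f_equal. extensionality x; destruct x. }
  rewrite <- Hs.
  (* The index is the length [k] of the given run; the context and the stack start out empty. *)
  eapply (proj1 (fundamental G) _ _ _ _ _ _ He k) with (κ := idC) (σ := []);
    [intros [] | apply le_n | apply krel_id | apply mrel_nil | apply le_n | exact Hk].
Qed.
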